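(* Let $\Phi\in H^\infty_{M_n}$ be a matrix rational function with $\det\Phi\not\equiv0$, and write $$\Phi=A^*\Theta\quad(\text{left coprime}),$$ where $\Theta$ is a finite Blaschke-Potapov product. Then, for every finite Blaschke product $\omega$, $$\Phi\circ\omega=(A\circ\omega)^*(\Theta\circ\omega)\quad(\text{left coprime}).$$
   Context: $H^2_{M_n}$, $H^\infty_{M_n}$: $n\times n$ matrix functions with entries in the Hardy spaces $H^2,H^\infty$ of the unit disk $\mathbb D$; the factorizations are identities a.e. on the unit circle $\mathbb T$. A matrix function is rational if each entry is. $\Theta\in H^\infty_{M_{n\times m}}$ is inner if $\Theta^*\Theta=I_m$ a.e. on $\mathbb T$. An inner $\Delta\in H^\infty_{M_{n\times m}}$ is a left inner divisor of $F\in H^2_{M_n}$ if $F=\Delta G$ with $G\in H^2_{M_{m\times n}}$; two functions are left coprime if their only common left inner divisors are unitary constants. ''$\Phi=A^*\Theta$ (left coprime)'' means $\Theta\in H^\infty_{M_n}$ is inner, $A\in H^2_{M_n}$, and $A$ and $\Theta$ are left coprime. A finite Blaschke-Potapov product is $\nu\prod_{m=1}^M\bigl(b_mP_m+(I-P_m)\bigr)$ with $\nu$ a constant unitary matrix, $b_m$ Blaschke factors and $P_m$ orthogonal projections on $\mathbb C^n$ (equivalently, a rational inner function in $H^\infty_{M_n}$). *)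

(* Defs.v *)
From mathcomp Require Import all_boot all_order all_algebra.
From mathcomp Require Import sesquilinear spectral.
From mathcomp Require Import all_classical all_reals all_analysis.
From mathcomp Require Import complex.

Set Implicit Arguments.
Unset Strict Implicit.
Unset Printing Implicit Defensive.

Import Order.TTheory GRing.Theory Num.Theory.
Import numFieldNormedType.Exports.

Local Open Scope classical_set_scope.
Local Open Scope ring_scope.
Local Open Scope sesquilinear_scope.

(* A function on the unit circle T is represented by a function on R[i], of
   which only the values on T matter; L^2, L^oo, H^2 and H^oo are the usual
   spaces on T, their elements being identified up to a.e. equality.
   T is parametrized by t |-> e^(it) on [0, 2 pi]. *)

Section CircleMeasure.
Context {R : realType}.
Local Notation C := R[i].

Definition circle (t : R) : C := (cos t +i* sin t)%C.

(* d theta on T, not normalized: only null sets, finiteness of norms and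
   vanishing of integrals are used below. *)
Definition arc_measure : {measure set (measurableTypeR R) -> \bar R} :=
  mrestr (@lebesgue_measure R) (measurable_itv `[0, 2 * pi]).

Definition aeT (P : C -> Prop) : Prop :=
  {ae arc_measure, forall t, P (circle t)}.

Definition LpT (p : \bar R) (f : C -> C) : Prop :=
  (fun t => complex.Re (f (circle t))) \in Lfun arc_measure p /\
  (fun t => complex.Im (f (circle t))) \in Lfun arc_measure p.

Definition integralT (f : C -> C) : C :=
  ((\int[arc_measure]_t complex.Re (f (circle t)))
    +i* (\int[arc_measure]_t complex.Im (f (circle t))))%C.

Definition fourier (f : C -> C) (k : int) : C :=
  ((2 * pi)^-1)%:C%C * integralT (fun z => f z * z ^ (- k)).

Definition HpT (p : \bar R) (f : C -> C) : Prop :=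
  LpT p f /\ forall k : int, k < 0 -> fourier f k = 0.

End CircleMeasure.

Section MatrixFunctions.
Context {R : realType}.
Local Notation C := R[i].

Definition H2 n m (F : C -> 'M[C]_(n, m)) : Prop :=
  forall i j, HpT 2%:E (fun z => F z i j).

Definition Hinfty n m (F : C -> 'M[C]_(n, m)) : Prop :=
  forall i j, HpT +oo%E (fun z => F z i j).

Definition rational_mx n m (F : C -> 'M[C]_(n, m)) : Prop :=
  forall i j, exists p q : {poly C},
    q != 0 /\ aeT (fun z => F z i j = p.[z] / q.[z]).

Definition inner n m (Theta : C -> 'M[C]_(n, m)) : Prop :=
  Hinfty Theta /\ aeT (fun z => (Theta z)^t* *m Theta z = 1%:M).

Definition left_inner_divisor n m k
    (Delta : C -> 'M[C]_(n, m)) (F : C -> 'M[C]_(n, k)) : Prop :=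
  inner Delta /\
  exists G : C -> 'M[C]_(m, k), H2 G /\ aeT (fun z => F z = Delta z *m G z).

(* The two equations force m = n. *)
Definition unitary_constant n m (Delta : C -> 'M[C]_(n, m)) : Prop :=
  exists U : 'M[C]_(n, m),
    [/\ U^t* *m U = 1%:M, U *m U^t* = 1%:M & aeT (fun z => Delta z = U)].

Definition left_coprime n k l
    (F : C -> 'M[C]_(n, k)) (G : C -> 'M[C]_(n, l)) : Prop :=
  forall m (Delta : C -> 'M[C]_(n, m)),
    left_inner_divisor Delta F -> left_inner_divisor Delta G ->
    unitary_constant Delta.

Definition left_coprime_factorization n
    (Phi A Theta : C -> 'M[C]_n) : Prop :=
  [/\ inner Theta, H2 A,
      aeT (fun z => Phi z = (A z)^t* *m Theta z) & left_coprime A Theta].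

Definition blaschke_factor (a z : C) : C := (z - a) / (1 - a^* * z).

Definition finite_blaschke_product (omega : C -> C) : Prop :=
  exists (c : C) (s : seq C),
    [/\ `|c| = 1, (forall a, a \in s -> `|a| < 1) &
        forall z, omega z = c * \prod_(a <- s) blaschke_factor a z].

Definition orthogonal_projection n (P : 'M[C]_n) : Prop :=
  P^t* = P /\ P *m P = P.

Definition finite_blaschke_potapov n (Theta : C -> 'M[C]_n) : Prop :=
  exists (nu : 'M[C]_n) (M : nat) (a : 'I_M -> C) (P : 'I_M -> 'M[C]_n),
    [/\ nu \is unitarymx,
        forall m, `|a m| < 1 /\ orthogonal_projection (P m) &
        aeT (fun z => Theta z = nu *m
          \prod_(m < M) (blaschke_factor (a m) z *: P m + (1%:M - P m)))].

Definition continuousT n m (F : C -> 'M[C]_(n, m)) : Prop :=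
  forall i j,
    continuous (fun t : R => complex.Re (F (circle t) i j)) /\
    continuous (fun t : R => complex.Im (F (circle t) i j)).

(* For nonconstant omega, F \o omega depends, up to a.e. equality on T, only on
   the a.e. class of F.  A unimodular constant is a finite Blaschke product of
   degree 0, for which F \o omega is the value of F at one point of T: then F
   has to be the continuous representative of its class. *)
Definition composable n m (F : C -> 'M[C]_(n, m)) (omega : C -> C) : Prop :=
  (exists c : C, forall z, `|z| = 1 -> omega z = c) -> continuousT F.

End MatrixFunctions.

(* Main.v *)
Require Import Defs.
From mathcomp Require Import all_boot all_order all_algebra.
From mathcomp Require Import all_classical all_reals all_analysis.
From mathcomp Require Import measurable_realfun ess_sup_inf complex.
From mathcomp Require Import ring lra.

Import Order.TTheory GRing.Theory Num.Theory.
Import numFieldNormedType.Exports.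
Local Open Scope classical_set_scope.
Local Open Scope ring_scope.
Set Implicit Arguments.
Unset Strict Implicit.
Unset Printing Implicit Defensive.

(** The proof replaces coprimeness by a Bezout identity, which composition preserves.

    On the circle Theta is unitary, so A = Theta Phi^*; hence A is rational and bounded,
    and as it lies in H2 it has no pole in the closed disc (cofactor_regular). Thus A and
    Theta are a.e. equal to matrices A' and T of rational functions without poles in the
    closed disc. If the columns of A' a and T a together failed to span C^n at a point a
    of the open disc, a row v with v A' a = 0 = v T a would produce the common left inner
    divisor b_a P + (1 - P), with P the projection on the line of v^*, and this divisor is
    not constant (left_coprime_pointwise); at points of the circle T a is invertible. An
    ideal argument in C[z] turns this pointwise statement into A' X + T Y = 1 with X and Y
    rational without poles in the closed disc (regular_bezout).

    Conversely, a Bezout identity a.e. on the circle implies left coprimeness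
    (left_coprime_bezout): if Delta is inner and divides both functions, then Delta K = 1
    with K in H2, and since Delta^* Delta = 1 this forces K = Delta^*; the entries of
    Delta and their conjugates are then all in H2, so they are constant. This last step
    rests on the uniqueness theorem for Fourier coefficients (fourier_eq0).

    A finite Blaschke product omega of positive degree maps the closed disc to itself, so
    the Bezout identity can be composed with omega. As A, Theta and Phi are only known
    a.e., one also needs that the preimage of a null set of the circle under omega is
    null (aeT_comp). This holds because the image of arc length under omega has the
    Poisson kernel at omega 0 as density: by the mean value property, both measures have
    the moments 2 pi (omega 0) ^ k. Equality of the moments implies equality on Borel
    sets by the same uniqueness theorem, proved once for both uses (annihilated_borel):
    indicators of arcs are bounded pointwise limits of trigonometric polynomials. *)

(** * Arc length and polynomial approximation of the step function *)

Section ArcMeasure.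
Context {R : realType}.
Local Notation mu := (@arc_measure R).

Lemma arc_measureT : mu setT = (2 * pi)%:E.
Proof.
rewrite /arc_measure /= /mrestr setTI lebesgue_measure_itv/= lte_fin.
by rewrite mulr_gt0 ?pi_gt0// -EFinB subr0.
Qed.

Lemma arc_measure_fin : mu setT \is a fin_num.
Proof. by rewrite arc_measureT. Qed.

Lemma integrable_arc_cst (c : R) : mu.-integrable setT (fun=> c%:E).
Proof.
apply: (@measurable_bounded_integrable _ _ _ _ (cst c)) => //.
- by rewrite ltey_eq arc_measure_fin.
- exists `|c|; split; first exact: num_real.
  by move=> x hx y _ /=; exact: ltW.
Qed.

Lemma aeT_arc (P : R -> Prop) :
  (forall t, 0 <= t <= 2 * pi -> P t) -> {ae mu, forall t, P t}.
Proof.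
move=> h; exists (~` `[0, 2 * pi]%classic); split.
- exact: measurableC.
- by rewrite /arc_measure /= /mrestr setICl measure0.
- by move=> t /= nP; apply: contra_not nP => Dt; apply: h; rewrite in_itv in Dt.
Qed.

End ArcMeasure.
Section Sign.
Context {R : realType}.
(** Iterates of x |-> (3 x - x ^ 3) / 2, which maps [-1, 1] to itself, has the
    attracting fixed points -1 and 1, and moves every other nonzero point towards the
    one of its own sign: on [-1, 1] they converge boundedly to the sign function. *)
Fixpoint sign_poly (k : nat) : {poly R} :=
  if k is k'.+1 then (3 / 2) *: sign_poly k' - 2^-1 *: (sign_poly k') ^+ 3
  else 'X.

Lemma sign_polyS k x : (sign_poly k.+1).[x] =
  (3 * (sign_poly k).[x] - (sign_poly k).[x] ^+ 3) / 2.
Proof. by rewrite /= !hornerE/= ; field. Qed.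

Lemma sign_polyN k x : (sign_poly k).[- x] = - (sign_poly k).[x].
Proof.
elim: k => [|k IH]; first by rewrite /= !hornerX.
by rewrite !sign_polyS IH; field.
Qed.

Lemma sign_poly_ge0 k x : 0 <= x <= 1 -> 0 <= (sign_poly k).[x] <= 1.
Proof.
move=> hx; elim: k => [|k]; first by rewrite /= hornerX.
rewrite sign_polyS; move: (horner _ _) => y /andP[y0 y1].
apply/andP; split; first by nra.
have : 0 <= (1 - y) ^+ 2 * (y + 2) by rewrite mulr_ge0 ?sqr_ge0//; lra.
by nra.
Qed.

Lemma sign_poly_bound k x : `|x| <= 1 -> `|(sign_poly k).[x]| <= 1.
Proof.
rewrite !ler_norml => /andP[h1 h2].
case: (lerP 0 x) => x0.
  have /(sign_poly_ge0 k) : 0 <= x <= 1 by lra.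
  by lra.
have /(sign_poly_ge0 k) : 0 <= - x <= 1 by lra.
by rewrite sign_polyN; lra.
Qed.

(** As 1 - (3 y - y ^ 3) / 2 = (1 - y) ^ 2 (y + 2) / 2, one iteration shrinks the
    distance to 1 at least by the factor 1 - x / 2 as long as y >= x. *)
Lemma sign_poly_cvg x : 0 < x <= 1 -> (sign_poly k).[x] @[k --> \oo] --> (1 : R).
Proof.
move=> /andP[x0 x1].
have ge k : x <= (sign_poly k).[x].
  elim: k => [|k IH]; first by rewrite /= hornerX.
  have /(sign_poly_ge0 k) : 0 <= x <= 1 by lra.
  rewrite sign_polyS; move: IH; move: (horner _ _) => y xy /andP[y0 y1].
  have : 0 <= y * ((1 - y) * (1 + y)) by rewrite !mulr_ge0//; lra.
  by lra.
have bnd k : 0 <= 1 - (sign_poly k).[x] <= (1 - x / 2) ^+ k.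
  elim: k => [|k /andP[h1 h2]].
    by rewrite /= hornerX expr0; lra.
  have := ge k; rewrite sign_polyS (exprS (1 - x / 2)); move: h1 h2; move: (horner _ _) => y h1 h2 hxy.
  have e : 1 - (3 * y - y ^+ 3) / 2 = (1 - y) * ((1 - y) * (y + 2) / 2) by field.
  have f0 : 0 <= (1 - y) * (y + 2) by rewrite mulr_ge0//; lra.
  have y2 : 0 <= y * y by rewrite mulr_ge0//; lra.
  rewrite e; apply/andP; split; first by rewrite mulr_ge0//; lra.
  rewrite [leLHS]mulrC.

  by rewrite ler_pM//; lra.
have : 1 - (sign_poly k).[x] @[k --> \oo] --> (0 : R).
  apply: (@squeeze_cvgr _ _ _ _ (cst 0) (fun k => (1 - x / 2) ^+ k)).
  - by apply: nearW.
  - exact: cvg_cst.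
  - by apply: cvg_expr; rewrite ger0_norm; lra.
move=> h; have : 1 - (1 - (sign_poly k).[x]) @[k --> \oo] --> (1 - 0 : R).
  by apply: cvgB => //; exact: cvg_cst.
rewrite subr0; under eq_fun do rewrite subKr. by [].
Qed.

(** (s + s ^ 2) / 2 is 1, 0, 0 when s is 1, 0, -1. *)
Definition step_poly k : {poly R} := 2^-1 *: (sign_poly k + sign_poly k ^+ 2).

Lemma step_poly_bound k x : `|x| <= 1 -> `|(step_poly k).[x]| <= 1.
Proof.
move=> /(sign_poly_bound k); rewrite /step_poly !hornerE; move: (horner _ _) => y.
by rewrite !ler_norml => /andP[? ?]; apply/andP; split; nra.
Qed.

Lemma step_poly_cvg x : `|x| <= 1 ->
  (step_poly k).[x] @[k --> \oo] --> (((0 < x)%R)%:R : R).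
Proof.
move=> x1.
pose s : R := if x == 0 then 0 else if 0 < x then 1 else -1.
have hs : (sign_poly k).[x] @[k --> \oo] --> s.
  rewrite /s; case: eqP => [->|/eqP x0].
    rewrite (_ : (fun k => _) = cst 0); first exact: cvg_cst.
    apply/funext => k /=; elim: k => [|k IH]; first by rewrite /= hornerX.
    by rewrite sign_polyS IH; field.
  case: ifPn => xp; first by apply: sign_poly_cvg; rewrite xp (le_trans (ler_norm _) x1).
  have xn : 0 < - x by rewrite oppr_gt0 lt_neqAle x0 leNgt.
  have := @sign_poly_cvg (- x); rewrite xn => /(_ _).
  move=> h; have {}h : (sign_poly k).[- x] @[k --> \oo] --> (1 : R).
    by apply: h; move: x1; rewrite ler_norml; lra.
  rewrite (_ : (fun k => _) = \- (fun k => (sign_poly k).[- x])).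
    exact: cvgN.
  by apply/funext => k; rewrite /= sign_polyN opprK.
have -> : (((0 < x)%R)%:R : R) = 2^-1 * (s + s ^+ 2).
  rewrite /s; case: (ltrgtP 0 x) => [xp|xn|_] /=.
  - by field.
  - by rewrite expr2 mulrNN mulr1 addNr mulr0.
  - by rewrite expr0n addr0 mulr0.
rewrite /step_poly; under eq_fun do rewrite !hornerE.
apply: cvgM; first exact: cvg_cst.
by apply: cvgD => //; rewrite expr2; apply: cvgM.
Qed.
End Sign.

(** * Uniqueness of trigonometric moments *)

Section Annihilator.
Context {R : realType}.
Local Notation mu := (@arc_measure R).
Variables (alpha : R) (tau g : R -> R).
Hypothesis mtau : measurable_fun setT tau.
Hypothesis tauD : forall t, 0 <= tau t <= 2 * pi.
Hypothesis ig : mu.-integrable setT (EFin \o g).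

(** Two situations are treated at once: alpha = 0, which tests the density g against u,
    and alpha = 1, which compares the image of arc length under tau with the measure
    of density - g. *)
Definition pairing (u : R -> R) t := alpha * u (tau t) + u t * g t.

Definition annihilated (u : R -> R) := [/\ measurable_fun setT u,
  exists M, forall t, `|u t| <= M &
  (\int[mu]_t (pairing u t)%:E = 0)%E].

Lemma measurable_pairing (u : R -> R) : measurable_fun setT u -> measurable_fun setT (pairing u).
Proof.
move=> mu_; apply: measurable_funD.
  by apply: measurable_funM => //; exact: measurableT_comp.
by apply: measurable_funM => //; have /measurable_int/measurable_EFinP := ig.
Qed.

Lemma integrable_dominating (M : R) :
  mu.-integrable setT (EFin \o (fun t => `|alpha| * M + M * `|g t|)).
Proof.
rewrite (_ : EFin \o _ = (fun=> (`|alpha| * M)%:E) \+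
  (fun t => M%:E * `|(EFin \o g) t|))%E; last first.
  by apply/funext => t /=; rewrite EFinD EFinM.
apply: integrableD => //; first exact: integrable_arc_cst.
by apply: integrableZl => //; exact: integrable_abse.
Qed.

Lemma pairing_bound (u : R -> R) (M : R) : (forall t, `|u t| <= M) ->
  forall t, `|pairing u t| <= `|alpha| * M + M * `|g t|.
Proof.
move=> hM t; rewrite (le_trans (ler_normD _ _))// !normrM lerD//.
  by rewrite ler_wpM2l.
by rewrite ler_wpM2r.
Qed.

Lemma integrable_pairing (u : R -> R) : measurable_fun setT u ->
  (exists M, forall t, `|u t| <= M) -> mu.-integrable setT (EFin \o pairing u).
Proof.
move=> mu_ [M hM]; apply: le_integrable (integrable_dominating M) => //.
  by apply/measurable_EFinP; exact: measurable_pairing.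
move=> t _; rewrite /= lee_fin (le_trans (pairing_bound hM t))//.
exact: ler_norm.
Qed.

Lemma annihilated_lin (a : R) (u v : R -> R) : annihilated u -> annihilated v ->
  annihilated (fun t => a * u t + v t).
Proof.
move=> [mu1 [M hM] u0] [mv [N hN] v0]; split.
- by apply: measurable_funD => //; exact: measurable_funM.
- exists (`|a| * M + N) => t; rewrite (le_trans (ler_normD _ _))// lerD//.
  by rewrite normrM ler_wpM2l.
- transitivity (\int[mu]_t (a%:E * (pairing u t)%:E + (pairing v t)%:E))%E.
    by apply: eq_integral => t _; rewrite -EFinM -EFinD /pairing; congr EFin; ring.
  have iu := integrable_pairing mu1 (ex_intro _ M hM).
  have iv := integrable_pairing mv (ex_intro _ N hN).
  rewrite integralD//; last exact: integrableZl.
  by rewrite integralZl// u0 v0 mule0 adde0.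
Qed.

Lemma annihilated_eq (u v : R -> R) : (forall t, 0 <= t <= 2 * pi -> u t = v t) ->
  measurable_fun setT v -> (exists M, forall t, `|v t| <= M) ->
  annihilated u -> annihilated v.
Proof.
move=> uv mv [M hM] [mu1 hu u0]; split=> //; first by exists M.
rewrite -u0; apply: ae_eq_integral => //.
- by apply/measurable_EFinP; exact: measurable_pairing.
- by apply/measurable_EFinP; exact: measurable_pairing.
- by apply: aeT_arc => t Dt _; rewrite /pairing !uv.
Qed.

Lemma annihilated_cvg (u_ : nat -> R -> R) (u : R -> R) (M : R) :
  (forall k, annihilated (u_ k)) -> (forall k t, `|u_ k t| <= M) ->
  (forall t, u_ k t @[k --> \oo] --> u t) -> annihilated u.
Proof.
move=> au bu cu.
have mu_ : measurable_fun setT u.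
  apply: (@measurable_fun_cvg _ _ _ _ u_) => //.
  by move=> k; have [] := au k.
have hu t : `|u t| <= M.
  have h : `|u_ k t| @[k --> \oo] --> `|u t| by exact: cvg_norm.
  rewrite -(cvg_lim (@Rhausdorff R) h).
  apply: limr_le; first by (apply/cvg_ex; exists `|u t|).
  by apply: nearW => k.
split=> //; first by exists M.
have [] // := @dominated_convergence _ _ _ mu setT measurableT
  (fun k => EFin \o pairing (u_ k)) (EFin \o pairing u)
  (EFin \o (fun t => `|alpha| * M + M * `|g t|)).
- move=> k /=; apply/measurable_EFinP; apply: measurable_pairing.
  by have [] := au k.
- by apply/measurable_EFinP; exact: measurable_pairing.
- apply: nearW => t _; apply: cvg_EFin; first exact: nearW.
  apply: cvgD; first by apply: cvgM => //; exact: cvg_cst.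
  by apply: cvgM => //; exact: cvg_cst.
- exact: integrable_dominating.
- by apply: nearW => t k _; rewrite /= lee_fin; exact: pairing_bound.
move=> _ _; rewrite (_ : [sequence _]_n = cst 0%E).
  by move=> /(cvg_lim (@ereal_hausdorff _)) <-; rewrite lim_cst.
by apply/funext => k /=; have [_ _] := au k.
Qed.

Hypothesis annihilated_cos : forall k : nat, annihilated (fun t => cos (k%:R * t)).
Hypothesis annihilated_sin : forall k : nat, annihilated (fun t => sin (k%:R * t)).

(** Unlike annihilation, this property is stable under multiplication by cos and sin,
    by the product formulas. *)
Definition trig_annihilated (u : R -> R) := forall k : nat,
  annihilated (fun t => u t * cos (k%:R * t)) /\
  annihilated (fun t => u t * sin (k%:R * t)).

Lemma trig_annihilated_lin (a : R) (u v : R -> R) : trig_annihilated u ->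
  trig_annihilated v -> trig_annihilated (fun t => a * u t + v t).
Proof.
move=> hu hv k; have [u1 u2] := hu k; have [v1 v2] := hv k.
split.
  rewrite (_ : (fun _ => _) = (fun t => a * (u t * cos (k%:R * t)) + v t * cos (k%:R * t))).
    exact: annihilated_lin.
  by apply/funext => t; ring.
rewrite (_ : (fun _ => _) = (fun t => a * (u t * sin (k%:R * t)) + v t * sin (k%:R * t))).
  exact: annihilated_lin.
by apply/funext => t; ring.
Qed.

Lemma trig_annihilated1 : trig_annihilated (fun=> 1).
Proof.
by move=> k; split; under eq_fun do rewrite mul1r.
Qed.

Lemma annihilated0 : annihilated (fun=> 0).
Proof.
rewrite (_ : (fun _ => _) = (fun t => -1 * sin (0%:R * t) + sin (0%:R * t))).
  by apply: annihilated_lin.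
by apply/funext => t; rewrite mul0r sin0 mulr0 addr0.
Qed.

Lemma trig_annihilated0 : trig_annihilated (fun=> 0).
Proof.
by move=> k; split; under eq_fun do rewrite mul0r; exact: annihilated0.
Qed.

Lemma trig_annihilated_cos (u : R -> R) : trig_annihilated u ->
  trig_annihilated (fun t => cos t * u t).
Proof.
move=> hu [|k].
  have [u1 u2] := hu 1; split.
    by under eq_fun do rewrite mul0r cos0 mulr1 -[X in cos X * _]mul1r mulrC.
  by under eq_fun do rewrite mul0r sin0 mulr0; exact: annihilated0.
have [u1 u2] := hu k; have [v1 v2] := hu k.+2.
have e1 (t : R) : k%:R * t = k.+1%:R * t - t by rewrite -(@natr1 _ k); ring.
have e2 (t : R) : k.+2%:R * t = k.+1%:R * t + t by rewrite -(@natr1 _ k.+1); ring.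
split.
  rewrite (_ : (fun _ => _) = (fun t => 2^-1 * (1 * (u t * cos (k%:R * t)) +
    u t * cos (k.+2%:R * t)) + 0)).
    by apply: annihilated_lin annihilated0; exact: annihilated_lin.
  by apply/funext => t; rewrite e1 e2 cosB cosD; field.
rewrite (_ : (fun _ => _) = (fun t => 2^-1 * (1 * (u t * sin (k%:R * t)) +
  u t * sin (k.+2%:R * t)) + 0)).
  by apply: annihilated_lin annihilated0; exact: annihilated_lin.
by apply/funext => t; rewrite e1 e2 sinB sinD; field.
Qed.

Lemma trig_annihilated_sin (u : R -> R) : trig_annihilated u ->
  trig_annihilated (fun t => sin t * u t).
Proof.
move=> hu [|k].
  have [u1 u2] := hu 1; split.
    by under eq_fun do rewrite mul0r cos0 mulr1 -[X in sin X * _]mul1r mulrC.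
  by under eq_fun do rewrite mul0r sin0 mulr0; exact: annihilated0.
have [u1 u2] := hu k; have [v1 v2] := hu k.+2.
have e1 (t : R) : k%:R * t = k.+1%:R * t - t by rewrite -(@natr1 _ k); ring.
have e2 (t : R) : k.+2%:R * t = k.+1%:R * t + t by rewrite -(@natr1 _ k.+1); ring.
split.
  rewrite (_ : (fun _ => _) = (fun t => 2^-1 * (-1 * (u t * sin (k%:R * t)) +
    u t * sin (k.+2%:R * t)) + 0)).
    by apply: annihilated_lin annihilated0; exact: annihilated_lin.
  by apply/funext => t; rewrite e1 e2 sinB sinD; field.
rewrite (_ : (fun _ => _) = (fun t => 2^-1 * (-1 * (u t * cos (k.+2%:R * t)) +
  u t * cos (k%:R * t)) + 0)).
  by apply: annihilated_lin annihilated0; exact: annihilated_lin.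
by apply/funext => t; rewrite e1 e2 cosB cosD; field.
Qed.

(** Polynomials in one real trigonometric polynomial of degree 1 are all that is needed
    to approximate indicators of arcs. *)
Lemma annihilated_poly (a b c : R) (p : {poly R}) :
  annihilated (fun t => p.[a * cos t + (b * sin t + c)]).
Proof.
suff : trig_annihilated (fun t => p.[a * cos t + (b * sin t + c)]).
  by move=> /(_ 0)[+ _]; under eq_fun do rewrite mul0r cos0 mulr1.
elim/poly_ind: p => [|p d IH].
  by under eq_fun do rewrite horner0; exact: trig_annihilated0.
rewrite (_ : (fun _ => _) = (fun t => let q := p.[a * cos t + (b * sin t + c)] in
  a * (cos t * q) + (b * (sin t * q) + (c * q + (d * 1 + 0))))); last first.
  by apply/funext => t; rewrite !hornerE /=; ring.
do ![apply: trig_annihilated_lin].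
- exact: trig_annihilated_cos.
- exact: trig_annihilated_sin.
- by [].
- exact: trig_annihilated1.
- exact: trig_annihilated0.
Qed.

(** For t in [0, 2 pi], the trigonometric polynomial sin ((t - a) / 2) sin ((b - t) / 2)
    is positive exactly on the arc ]a, b[, so its compositions with the step
    polynomials converge boundedly to the indicator of the arc. *)
Lemma annihilated_itv (a b : R) : 0 <= a -> a <= b -> b <= 2 * pi ->
  annihilated (\1_(`]a, b[%classic)).
Proof.
move=> a0 ab b2.
pose h (t : R) := (cos ((a + b) / 2) / 2) * cos t +
  ((sin ((a + b) / 2) / 2) * sin t + - (cos ((b - a) / 2) / 2)).
have hE t : h t = (cos (t - (a + b) / 2) - cos ((b - a) / 2)) / 2.
  by rewrite cosB /h; field.
have hS t : h t = sin ((t - a) / 2) * sin ((b - t) / 2).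
  rewrite hE (_ : t - _ = (t - a) / 2 - (b - t) / 2); last by field.
  rewrite (_ : (b - a) / 2 = (t - a) / 2 + (b - t) / 2); last by field.
  by rewrite cosB cosD; field.
have hb t : `|h t| <= 1.
  rewrite hE ler_norml.
  have := cos_geN1 (t - (a + b) / 2); have := cos_le1 (t - (a + b) / 2).
  have := cos_geN1 ((b - a) / 2); have := cos_le1 ((b - a) / 2).
  by lra.
have A : annihilated (fun t => ((0 < h t)%R)%:R).
  apply: (@annihilated_cvg (fun k t => (step_poly k).[h t]) _ 1).
  - by move=> k; exact: annihilated_poly.
  - by move=> k t; exact: step_poly_bound.
  - by move=> t; exact: step_poly_cvg.
apply: annihilated_eq A => //.
- move=> t /andP[t0 t2]; rewrite indicE; congr ((nat_of_bool _)%:R); rewrite mem_setE in_itv/=.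
  have pi0 := pi_gt0 R.
  case: (ltP a t) => ta /=; last first.
    rewrite hS; apply/negbTE; rewrite -leNgt mulr_le0_ge0//.
      rewrite -oppr_ge0 -sinN sin_ge0_pi//; lra.
    rewrite sin_ge0_pi//; lra.
  case: (ltP t b) => tb; last first.
    rewrite hS; apply/negbTE; rewrite -leNgt mulr_ge0_le0//.
      rewrite sin_ge0_pi//; lra.
    rewrite -oppr_ge0 -sinN sin_ge0_pi//; lra.
  by rewrite hS mulr_gt0// sin_gt0_pi//; lra.
- by exists 1 => t; rewrite indicE; case: (_ \in _); rewrite ?normr1// normr0.
Qed.

(** The uniqueness theorem for trigonometric moments: dominated convergence gives
    arcs, and the pi-lambda theorem gives Borel sets. *)
Lemma annihilated_borel (E : set R) : measurable E ->
  annihilated (\1_(E `&` `]0, 2 * pi[)).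
Proof.
move=> mE.
have m2 (F : set R) : measurable F -> measurable (F `&` `]0, 2 * pi[).
  by move=> mF; apply: measurableI => //; exact: measurable_itv.
pose H := [set F : set R | measurable F /\ annihilated (\1_(F `&` `]0, 2 * pi[))].
suff : <<s setT, @RGenOpens.G R >> `<=` H.
  move=> sub; have [] // := sub E _.
  by have := mE; rewrite /measurable/= /measurableR RGenOpens.measurableE.
apply: lambda_system_subset.
- move=> _ _ [a [b ->]] [c [d ->]]; exists (Num.max a c), (Num.min b d).
  by rewrite predeqE => t /=; rewrite !in_itv/= gt_max lt_min; lra.
- split=> //.
  + split; first exact: measurableT.
    by rewrite setTI; apply: annihilated_itv => //; rewrite mulr_ge0 ?pi_ge0.
  + move=> A B BA [mA aA] [mB aB]; split; first exact: measurableD.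
    rewrite (_ : \1_ _ = (fun t => -1 * \1_(B `&` `]0, 2 * pi[) t +
        \1_(A `&` `]0, 2 * pi[) t)); first exact: annihilated_lin.
    apply/funext => t; rewrite setDE !indicE !in_setI in_setC.
    case: (boolP (t \in B)) => tB /=.
      have -> : t \in A by rewrite inE; apply: BA; rewrite inE in tB.
      by case: (t \in _); rewrite /= ?mulr1 ?mulr0; ring.
    by case: (t \in A); case: (t \in _); rewrite /= ?mulr1 ?mulr0; ring.
  + move=> F ndF HF; split; first by apply: bigcupT_measurable => k; have [] := HF k.
    apply: (@annihilated_cvg (fun k => \1_(F k `&` `]0, 2 * pi[)) _ 1).
    * by move=> k; have [] := HF k.
    * by move=> k t; rewrite indicE; case: (_ \in _); rewrite ?normr1// normr0.
    * move=> t; apply: cvg_near_cst.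
      case: (pselect ((\bigcup_k F k) t)) => [[n _ Fnt]|nF].
        near=> k; rewrite !indicE !in_setI.
        have nk : (n <= k)%N by near: k; exact: nbhs_infty_ge.
        have -> : t \in F k by rewrite inE; move/subsetPset: (ndF _ _ nk); apply.
        by have -> : t \in \bigcup_k F k by rewrite inE; exists n.
      apply: nearW => k; rewrite !indicE !in_setI.
      have -> : t \in F k = false.
        by apply/negbTE; apply: contra_notN nF; rewrite inE => Fk; exists k.
      by have -> : t \in \bigcup_k F k = false by apply/negbTE; rewrite notin_setE.
- move=> _ [a [b ->]]; split; first exact: measurable_itv.
  have pi0 := pi_gt0 R.
  rewrite (_ : _ `&` _ = `](Num.max a 0), (Num.min b (2 * pi))[%classic); last first.
    by rewrite predeqE => t /=; rewrite !in_itv/= gt_max lt_min; lra.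
  case: (lerP (Num.max a 0) (Num.min b (2 * pi))) => ab.
    by apply: annihilated_itv => //; rewrite ?le_max ?ge_min lexx orbT.
  rewrite (_ : \1_ _ = (fun=> 0)); first exact: annihilated0.
  by rewrite set_itv_ge ?indic0// bnd_simp -leNgt ltW.
- by [].
Unshelve. all: by end_near. Qed.
End Annihilator.

(** * Complex numbers and functions on the circle *)

Section ComplexParts.
Context {R : realType}.
Local Notation C := R[i].
Implicit Types x y : C.

Lemma Re_mul x y : complex.Re (x * y) =
  complex.Re x * complex.Re y - complex.Im x * complex.Im y.
Proof. by case: x y => [a b] [c d]. Qed.

Lemma Im_mul x y : complex.Im (x * y) =
  complex.Re x * complex.Im y + complex.Im x * complex.Re y.
Proof. by case: x y => [a b] [c d]. Qed.

Lemma Re_add x y : complex.Re (x + y) = complex.Re x + complex.Re y.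
Proof. by case: x y => [a b] [c d]. Qed.

Lemma Im_add x y : complex.Im (x + y) = complex.Im x + complex.Im y.
Proof. by case: x y => [a b] [c d]. Qed.

Lemma Re_real (a : R) : complex.Re (a%:C)%C = a. Proof. by []. Qed.
Lemma Im_real (a : R) : complex.Im (a%:C)%C = 0. Proof. by []. Qed.

Lemma conjC_conjc x : x^* = conjc x.
Proof. by []. Qed.

Lemma Re_conjC x : complex.Re x^* = complex.Re x.
Proof. by rewrite conjC_conjc; case: x. Qed.

Lemma Im_conjC x : complex.Im x^* = - complex.Im x.
Proof. by rewrite conjC_conjc; case: x. Qed.

Lemma complex_ext x y : complex.Re x = complex.Re y ->
  complex.Im x = complex.Im y -> x = y.
Proof. by case: x y => [a b] [c d] /= -> ->. Qed.

Lemma norm_Re_le x (M : R) : `|x| <= (M%:C)%C -> `|complex.Re x| <= M.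
Proof. by move=> h; rewrite -lecR (le_trans (normc_ge_Re x)). Qed.

Lemma norm_Im_le x (M : R) : `|x| <= (M%:C)%C -> `|complex.Im x| <= M.
Proof.
move=> h; have := @norm_Re_le (x * 'i%C) M.
rewrite ReiNIm normrN; apply; rewrite normrM (_ : `|'i%C| = 1) ?mulr1//.
by rewrite normc_def /= expr0n expr1n add0r sqrtr1.
Qed.

Lemma norm_le_ReIm x : `|x| <= ((`|complex.Re x| + `|complex.Im x|)%:C)%C.
Proof.
rewrite normc_def lecR.
rewrite -[leRHS]ger0_norm ?addr_ge0// -sqrtr_sqr ler_wsqrtr//.
rewrite sqrrD !real_normK ?num_real// lerD2r lerDl.
by rewrite mulrn_wge0// mulr_ge0.
Qed.

End ComplexParts.

Section Circle.
Context {R : realType}.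
Local Notation C := R[i].

Lemma norm_circle (t : R) : `|circle t| = 1 :> C.
Proof. by rewrite normc_def /= cos2Dsin2 sqrtr1. Qed.

Lemma circle_neq0 (t : R) : circle t != 0 :> C.
Proof. by rewrite -normr_eq0 norm_circle oner_eq0. Qed.

Lemma conj_circle (t : R) : (circle t)^* = (circle t)^-1 :> C.
Proof.
apply: (mulfI (circle_neq0 t)); rewrite mulfV ?circle_neq0// -normCK.
by rewrite norm_circle expr1n.
Qed.

Lemma circleD (s t : R) : circle (s + t) = circle s * circle t :> C.
Proof.
by apply: complex_ext; rewrite ?Re_mul ?Im_mul /= ?cosD ?sinD// addrC [X in _ + X]mulrC.
Qed.

Lemma circleX (t : R) k : circle t ^+ k = circle (k%:R * t) :> C.
Proof.
elim: k => [|k IH].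
  by rewrite expr0 mul0r; apply: complex_ext; rewrite /= ?cos0 ?sin0.
by rewrite exprS IH -natr1 mulrDl mul1r addrC circleD.
Qed.

End Circle.

Section MeasurableOnCircle.
Context {R : realType}.
Local Notation C := R[i].
Implicit Types f g : C -> C.

Definition measT f := measurable_fun setT (fun t : R => complex.Re (f (circle t))) /\
  measurable_fun setT (fun t : R => complex.Im (f (circle t))).

Lemma measT_cst (c : C) : measT (fun=> c).
Proof. by split; exact: measurable_cst. Qed.

Lemma measT_id : measT id.
Proof.
split; apply: continuous_measurable_fun; first exact: continuous_cos.
exact: continuous_sin.
Qed.

Lemma measTD f g : measT f -> measT g -> measT (fun z => f z + g z).
Proof.
move=> [fr fi] [gr gi]; split.
  by under eq_fun do rewrite Re_add; exact: measurable_funD.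
by under eq_fun do rewrite Im_add; exact: measurable_funD.
Qed.

Lemma measTM f g : measT f -> measT g -> measT (fun z => f z * g z).
Proof.
move=> [fr fi] [gr gi]; split.
  under eq_fun do rewrite Re_mul.
  by apply: measurable_funB; exact: measurable_funM.
under eq_fun do rewrite Im_mul.
by apply: measurable_funD; exact: measurable_funM.
Qed.

Lemma measT_conj f : measT f -> measT (fun z => (f z)^*).
Proof.
move=> [fr fi]; split; first by under eq_fun do rewrite Re_conjC.
by under eq_fun do rewrite Im_conjC; exact: measurableT_comp.
Qed.

Lemma measTV f : measT f -> measT (fun z => (f z)^-1).
Proof.
move=> mf; have [fr fi] := mf.
pose n2 t := complex.Re (f (circle t)) ^+ 2 + complex.Im (f (circle t)) ^+ 2.
have mn : measurable_fun setT (fun t => n2 t `^ (-1)).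
  apply: (@measurableT_comp _ _ _ _ _ _ (@powR R ^~ (-1))) => //.
  by apply: measurable_funD; apply: measurable_funX.
have e t : (f (circle t))^-1 = ((n2 t `^ (-1))%:C)%C * (f (circle t))^*.
  rewrite powR_inv1 ?addr_ge0 ?sqr_ge0//.
  rewrite invc_norm -[`|_| ^- 2]/((`|_| ^+ 2)^-1) -add_Re2_Im2.
  by rewrite -[conjc _]conjC_conjc fmorphV.
have [cr ci] := measT_conj mf.
split.
  under eq_fun do rewrite e Re_mul Re_real Im_real mul0r subr0.
  exact: measurable_funM.
under eq_fun do rewrite e Im_mul Re_real Im_real mul0r addr0.
exact: measurable_funM.
Qed.

Lemma measTX f k : measT f -> measT (fun z => f z ^+ k).
Proof.
move=> mf; elim: k => [|k IH]; first by under eq_fun do rewrite expr0; exact: measT_cst.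
by under eq_fun do rewrite exprS; exact: measTM.
Qed.

Lemma measT_exprz (k : int) : measT (fun z => z ^ k).
Proof.
case: k => k; first exact: measTX measT_id.
by apply: measTV; exact: measTX measT_id.
Qed.

End MeasurableOnCircle.

Section AlmostEverywhere.
Context {R : realType}.
Local Notation C := R[i].
Local Notation mu := (@arc_measure R).

Let ae_filter : Filter (almost_everywhere mu).
Proof. exact: ae_filter_ringOfSetsType. Qed.

Lemma aeT_and (P Q : C -> Prop) : aeT P -> aeT Q -> aeT (fun z => P z /\ Q z).
Proof. by move=> hP hQ; exact: (@filterI _ _ ae_filter _ _ hP hQ). Qed.

Lemma aeT_imp (P Q : C -> Prop) : (forall t, P (circle t) -> Q (circle t)) ->
  aeT P -> aeT Q.
Proof. by move=> PQ; exact: (@filterS _ _ ae_filter _ _ PQ). Qed.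

Lemma aeT_all (P : C -> Prop) : (forall t, P (circle t)) -> aeT P.
Proof. by move=> hP; exact: (@aeW _ _ _ mu). Qed.

Lemma aeT_forall (I : finType) (P : I -> C -> Prop) : (forall i, aeT (P i)) ->
  aeT (fun z => forall i, P i z).
Proof. by move=> hP; exact: (@filter_forall _ _ (fun i t => P i (circle t)) _ ae_filter hP). Qed.

(** Null sets have empty interior. *)
Lemma aeT_dense (P : C -> Prop) (t0 e : R) : aeT P -> 0 <= t0 <= 2 * pi -> 0 < e ->
  exists t, [/\ 0 < t < 2 * pi, `|t - t0| < e & P (circle t)].
Proof.
move=> [N [mN N0 PN]] /andP[t00 t02] e0.
have pi0 := pi_gt0 R.
pose a := Num.max 0 (t0 - e); pose b := Num.min (2 * pi) (t0 + e).
have ab : a < b by rewrite /a /b gt_max !lt_min; lra.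
apply: contrapT => nex.
have sub : `]a, b[%classic `<=` N.
  move=> t /=; rewrite in_itv /a /b /= gt_max lt_min => ht.
  apply: PN => /= Pt; apply: nex; exists t; split=> //; first by lra.
  by rewrite ltr_norml; lra.
have : (arc_measure `]a, b[%classic <= 0)%E.
  by rewrite -N0; apply: le_measure => //; rewrite inE//; exact: measurable_itv.
rewrite /arc_measure /= /mrestr (_ : _ `&` _ = `]a, b[%classic); last first.
  rewrite predeqE => t /=; rewrite !in_itv/= /a /b gt_max lt_min; lra.
by rewrite lebesgue_measure_itv/= lte_fin ab -EFinB lee_fin; lra.
Qed.

End AlmostEverywhere.

(** * Lebesgue spaces and integrals on the circle *)

Section RealL2.
Context {R : realType}.
Local Notation mu := (@arc_measure R).

Lemma Lfun2_mul_bounded (u f : R -> R) (M : R) : measurable_fun setT u ->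
  (forall t, `|u t| <= M) -> f \in Lfun mu 2%:E -> (fun t => u t * f t) \in Lfun mu 2%:E.
Proof.
move=> mu_ uM hf.
have mf : measurable_fun setT f by have := sub_Lfun_mfun hf; rewrite inE.
have M0 : 0 <= M by exact: le_trans (uM 0).
have /Lfun_integrable := hf; rewrite ler1n => /(_ isT) i2.
have muf : measurable_fun setT (fun t => u t * f t) by exact: measurable_funM.
rewrite inE; apply/andP; split; rewrite inE//=.
rewrite /finite_norm unlock poweR_lty//.
suff : mu.-integrable setT (fun t => (`|u t * f t| `^ 2)%:E).
  move=> /integrableP[_]; apply: le_lt_trans; apply: ge0_le_integral => //.
  - by move=> t _; exact: poweR_ge0.
  - apply/measurable_EFinP => /=.
    apply: (@measurableT_comp _ _ _ _ _ _ (@powR R ^~ 2)) => //.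
    exact: measurableT_comp.
  - apply: measurableT_comp => //; apply/measurable_EFinP => /=.
    apply: (@measurableT_comp _ _ _ _ _ _ (@powR R ^~ 2)) => //.
    exact: measurableT_comp.
  - by move=> t _; rewrite /= lee_fin ler_norm.
have : mu.-integrable setT (fun t => (M ^+ 2)%:E * (`|f t| `^ 2)%:E)%E.
  exact: integrableZl.
apply: le_integrable => //.
  apply/measurable_EFinP => /=.
  apply: (@measurableT_comp _ _ _ _ _ _ (@powR R ^~ 2)) => //.
  exact: measurableT_comp.
move=> t _; rewrite /= lee_fin !powR_mulrn// ger0_norm ?exprn_ge0//.
rewrite [leRHS]ger0_norm ?mulr_ge0 ?exprn_ge0// -exprMn normrM.
by rewrite lerXn2r ?nnegrE ?mulr_ge0// ler_wpM2r.
Qed.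

End RealL2.

Section CircleLp.
Context {R : realType}.
Local Notation C := R[i].
Local Notation mu := (@arc_measure R).
Implicit Types f g : C -> C.

Definition intT f := mu.-integrable setT (fun t => (complex.Re (f (circle t)))%:E) /\
  mu.-integrable setT (fun t => (complex.Im (f (circle t)))%:E).

Lemma LpT_measT p f : LpT p f -> measT f.
Proof.
move=> [/sub_Lfun_mfun + /sub_Lfun_mfun]; rewrite !inE => h1 h2; by split.
Qed.

Lemma LpT_subset (p q : \bar R) f : (1 <= p)%E -> (1 <= q)%E -> (p <= q)%E ->
  LpT q f -> LpT p f.
Proof.
by move=> p1 q1 pq [h1 h2]; split; apply: Lfun_subset pq _ _ => //;
  exact: arc_measure_fin.
Qed.

Lemma LpT_int p f : (1 <= p)%E -> LpT p f -> intT f.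
Proof.
by move=> p1 /(LpT_subset (lexx _) p1 p1)[h1 h2]; split; apply/Lfun1_integrable.
Qed.

Lemma LpT_ooP f : LpT +oo%E f <-> measT f /\ exists M : R, aeT (fun z => `|f z| <= (M%:C)%C).
Proof.
have m0 : (0 < mu setT)%E by rewrite arc_measureT lte_fin mulr_gt0 ?pi_gt0.
split=> [h|[[mr mi] [M hM]]].
  split; first exact: LpT_measT h.
  move: h => -[]; rewrite !inE => /andP[_ +] /andP[_]; rewrite !inE /finite_norm.
  rewrite !unlock m0 => /ess_supr_bounded[M hM] /ess_supr_bounded[N hN].
  have hM' : aeT (fun z => `|complex.Re (f z)| <= M) by exact: hM.
  have hN' : aeT (fun z => `|complex.Im (f z)| <= N) by exact: hN.
  exists (M + N); apply: aeT_imp (aeT_and hM' hN') => t [h1 h2].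
  by rewrite (le_trans (norm_le_ReIm _))// lecR lerD.
split; rewrite inE; apply/andP; split; rewrite inE//= /finite_norm unlock m0.
  apply: (@le_lt_trans _ _ M%:E); last exact: ltry.
  have h : aeT (fun z => `|complex.Re (f z)|%:E <= M%:E)%E.
    by apply: aeT_imp hM => t ht; rewrite lee_fin; exact: norm_Re_le.
  by apply/ess_supP; exact: h.
apply: (@le_lt_trans _ _ M%:E); last exact: ltry.
have h : aeT (fun z => `|complex.Im (f z)|%:E <= M%:E)%E.
  by apply: aeT_imp hM => t ht; rewrite lee_fin; exact: norm_Im_le.
by apply/ess_supP; exact: h.
Qed.

Lemma LpTD p f g : (1 <= p)%E -> LpT p f -> LpT p g -> LpT p (fun z => f z + g z).
Proof.
move=> p1 [fr fi] [gr gi]; have [_ addL] := Lfun_addr_closed mu p1; split.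
  by under eq_fun do rewrite Re_add; exact: addL.
by under eq_fun do rewrite Im_add; exact: addL.
Qed.

Lemma LpT2M_bounded f g (M : R) : measT f ->
  (forall t, `|f (circle t)| <= (M%:C)%C) -> LpT 2%:E g -> LpT 2%:E (fun z => f z * g z).
Proof.
move=> [fr fi] fM [gr gi].
have p1 : (1 <= 2%:E :> \bar R)%E by rewrite lee1n.
have [_ addL] := Lfun_addr_closed mu p1.
have oppL := @Lfun_oppr_closed _ _ _ mu 2%:E.
split.
  under eq_fun do rewrite Re_mul.
  apply: (addL _ (fun t => - _)).
    by apply: (@Lfun2_mul_bounded _ _ _ M) => // t; exact: norm_Re_le.
  apply: oppL.
  by apply: (@Lfun2_mul_bounded _ _ _ M) => // t; exact: norm_Im_le.
under eq_fun do rewrite Im_mul.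
apply: addL.
  by apply: (@Lfun2_mul_bounded _ _ _ M) => // t; exact: norm_Re_le.
by apply: (@Lfun2_mul_bounded _ _ _ M) => // t; exact: norm_Im_le.
Qed.

Lemma integralT_eq f g : (forall t, f (circle t) = g (circle t)) ->
  integralT f = integralT g.
Proof. by move=> fg; rewrite /integralT; under eq_Rintegral do rewrite fg;
 congr Complex; apply: eq_Rintegral => t _; rewrite fg. Qed.

Lemma intTD f g : intT f -> intT g -> intT (fun z => f z + g z).
Proof.
move=> [fr fi] [gr gi]; split.
  by under eq_fun do rewrite Re_add EFinD; exact: integrableD.
by under eq_fun do rewrite Im_add EFinD; exact: integrableD.
Qed.

Lemma intTZ (c : C) f : intT f -> intT (fun z => c * f z).
Proof.
move=> [fr fi]; split.
  under eq_fun do rewrite Re_mul EFinB !EFinM.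
  by apply: integrableB => //; exact: integrableZl.
under eq_fun do rewrite Im_mul EFinD !EFinM.
by apply: integrableD => //; exact: integrableZl.
Qed.

Lemma integralTD f g : intT f -> intT g ->
  integralT (fun z => f z + g z) = integralT f + integralT g.
Proof.
move=> [fr fi] [gr gi]; apply: complex_ext; rewrite /= ?Re_add ?Im_add/=.
  by under eq_Rintegral do rewrite Re_add; rewrite RintegralD.
by under eq_Rintegral do rewrite Im_add; rewrite RintegralD.
Qed.

Let integrableZ (a : R) (u : R -> R) : mu.-integrable setT (fun t => (u t)%:E) ->
  mu.-integrable setT (EFin \o (fun t => a * u t)).
Proof.
move=> iu; rewrite (_ : EFin \o _ = (fun t => a%:E * (u t)%:E)%E).
  exact: integrableZl.
by apply/funext => t; rewrite /= EFinM.
Qed.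

Lemma integralTZ (c : C) f : intT f ->
  integralT (fun z => c * f z) = c * integralT f.
Proof.
move=> [fr fi]; apply: complex_ext; rewrite /= ?Re_mul ?Im_mul/=.
  under eq_Rintegral do rewrite Re_mul.
  by rewrite RintegralB ?RintegralZl//; exact: integrableZ.
under eq_Rintegral do rewrite Im_mul.
by rewrite RintegralD ?RintegralZl//; exact: integrableZ.
Qed.

Lemma integralT_conj f : intT f -> integralT (fun z => (f z)^*) = (integralT f)^*.
Proof.
move=> [fr fi]; apply: complex_ext; rewrite ?Re_conjC ?Im_conjC/=.
  by under eq_Rintegral do rewrite Re_conjC.
under eq_Rintegral do rewrite Im_conjC -mulN1r.
by rewrite RintegralZl// mulN1r.
Qed.

Lemma integralT_ae f g : measT f -> measT g -> aeT (fun z => f z = g z) ->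
  integralT f = integralT g.
Proof.
move=> [fr fi] [gr gi] fg; rewrite /integralT /Rintegral; congr Complex; congr fine.
  apply: ae_eq_integral => //; try by apply/measurable_EFinP.
  by apply: (@filterS _ _ (ae_filter_ringOfSetsType mu)) fg => t /= -> _.
apply: ae_eq_integral => //; try by apply/measurable_EFinP.
by apply: (@filterS _ _ (ae_filter_ringOfSetsType mu)) fg => t /= -> _.
Qed.

Lemma integralT_cst (c : C) : integralT (fun=> c) = c * ((2 * pi)%:C)%C.
Proof.
rewrite /integralT !Rintegral_cst//= arc_measureT/=.
by apply: complex_ext; rewrite ?Re_mul ?Im_mul/= mulr0 ?subr0 ?add0r.
Qed.

Lemma intT_measT f : intT f -> measT f.
Proof.
move=> [fr fi]; split; apply/measurable_EFinP.
  exact: measurable_int fr.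
exact: measurable_int fi.
Qed.

Lemma integrable_ReIm f : intT f -> mu.-integrable setT
  (EFin \o (fun t => `|complex.Re (f (circle t))| + `|complex.Im (f (circle t))|)).
Proof.
move=> [fr fi]; rewrite (_ : EFin \o _ = (fun t => `|(complex.Re (f (circle t)))%:E| +
     `|(complex.Im (f (circle t)))%:E|)%E).
  by apply: integrableD => //; exact: integrable_abse.
by apply/funext => t; rewrite /= EFinD.
Qed.

Lemma unimodular_parts (x y : C) : `|y| = 1 ->
  `|complex.Re (x * y)| <= `|complex.Re x| + `|complex.Im x| /\
  `|complex.Im (x * y)| <= `|complex.Re x| + `|complex.Im x|.
Proof.
move=> y1.
have yr : `|complex.Re y| <= 1 by apply: norm_Re_le; rewrite y1.
have yi : `|complex.Im y| <= 1 by apply: norm_Im_le; rewrite y1.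
split; rewrite ?Re_mul ?Im_mul.
  by rewrite (le_trans (ler_normB _ _))// !normrM lerD// ler_piMr.
by rewrite addrC (le_trans (ler_normD _ _))// !normrM addrC lerD// ler_piMr.
Qed.

Lemma intTM_unimodular f u : intT f -> measT u -> (forall t, `|u (circle t)| = 1) ->
  intT (fun z => f z * u z).
Proof.
move=> intf mu_ u1; have ih := integrable_ReIm intf.
have [mr mi] := measTM (intT_measT intf) mu_.
split; apply: le_integrable ih => //; try exact/measurable_EFinP.
  move=> t _; rewrite /= lee_fin [leRHS]ger0_norm ?addr_ge0//.
  by have [] := unimodular_parts (f (circle t)) (u1 t).
move=> t _; rewrite /= lee_fin [leRHS]ger0_norm ?addr_ge0//.
by have [] := unimodular_parts (f (circle t)) (u1 t).
Qed.

(** Uniformity in u is what bounds all Fourier coefficients of f at once. *)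
Lemma integralT_unimodular_bound f : intT f -> exists M : R, forall u : C -> C,
  measT u -> (forall t, `|u (circle t)| = 1) ->
  `|integralT (fun z => f z * u z)| <= (M%:C)%C.
Proof.
move=> intf; have ih := integrable_ReIm intf.
pose h t := `|complex.Re (f (circle t))| + `|complex.Im (f (circle t))|.
exists (\int[mu]_t h t + \int[mu]_t h t) => u mu_ u1.
have [ir ii] := intTM_unimodular intf mu_ u1.
have key (v : R -> R) : mu.-integrable setT (EFin \o v) -> (forall t, `|v t| <= h t) ->
    `|\int[mu]_t v t| <= \int[mu]_t h t.
  move=> iv vh; apply: le_trans (le_normr_Rintegral _ iv) _ => //.
  apply: le_Rintegral => //.
  by rewrite (_ : EFin \o _ = (fun t => `|(EFin \o v) t|)%E) //; exact: integrable_abse.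
rewrite (le_trans (norm_le_ReIm _))// lecR lerD//=; apply: key => // t.
  by have [] := unimodular_parts (f (circle t)) (u1 t).
by have [] := unimodular_parts (f (circle t)) (u1 t).
Qed.

End CircleLp.

Section ArcIntegral.
Context {R : realType}.
Local Notation mu := (@arc_measure R).
Local Notation leb := (@lebesgue_measure R).

Lemma integral_arc (f : R -> \bar R) : measurable_fun setT f ->
  (\int[mu]_t f t = \int[leb]_(t in `[0%R, (2 * pi)%R]) f t)%E.
Proof.
move=> mf; have mD : measurable (`[0, 2 * pi]%classic : set R) by exact: measurable_itv.
transitivity (\int[mu]_(t in `[0%R, (2 * pi)%R]) f t)%E; last first.
  apply: eq_measure_integral => A mA AD.
  by rewrite /arc_measure /= /mrestr setIidl.
rewrite [RHS]integral_mkcond; apply: ae_eq_integral => //.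
  by apply/(measurable_restrictT _ mD); exact: measurable_funTS.
by apply: aeT_arc => t Dt _; rewrite patchE ifT// inE/= in_itv.
Qed.

Lemma Rintegral_arc_derive (f F : R -> R) : continuous f ->
  (forall t : R, is_derive t 1 F (f t)) -> \int[mu]_t f t = F (2 * pi) - F 0.
Proof.
move=> cf dF; rewrite /Rintegral integral_arc; last first.
  by apply/measurable_EFinP; exact: continuous_measurable_fun.
have cF : continuous F.
  move=> t; apply: differentiable_continuous; apply/derivable1_diffP.
  by have [] := dF t.
rewrite (@continuous_FTC2 _ f F)//.
- by rewrite mulr_gt0 ?pi_gt0.
- exact: continuous_subspaceT.
- split; first by move=> t _; have [] := dF t.
  + exact/cvg_at_right_filter/cF.
  + exact/cvg_at_left_filter/cF.
- by move=> t _; rewrite derive1E; have [] := dF t.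
Qed.

Lemma continuous_scaled (k : R) (h : R -> R) : continuous h ->
  continuous (fun t => h (k * t)).
Proof.
move=> ch t; apply: (@continuous_comp _ _ _ ( *%R k) h); last exact: ch.
by apply: cvgM; [exact: cvg_cst | exact: cvg_id].
Qed.

Lemma circle2pi_mul k : circle (k%:R * (2 * pi)) = 1 :> R[i].
Proof.
have -> : 2 * pi = pi *+ 2 :> R by rewrite mulr_natl.
rewrite -circleX (_ : circle (pi *+ 2) = 1) ?expr1n//.
by apply: complex_ext; rewrite /= ?cos2pi ?sin2pi.
Qed.

Lemma integral_cos k : \int[mu]_t cos (k.+1%:R * t) = 0.
Proof.
pose F (t : R) := (k.+1%:R)^-1 * sin (k.+1%:R * t).
have dF (t : R) : is_derive t (1 : R) F (cos (k.+1%:R * t)).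
  apply: is_derive_eq.
  by rewrite /GRing.scale /= mulr1 mulrCA mulVf ?mulr1.
rewrite (Rintegral_arc_derive _ dF).
  by rewrite /F; have [_ ->] := circle2pi_mul k.+1; rewrite !mulr0 sin0 mulr0 subrr.
by apply: (@continuous_scaled k.+1%:R cos); exact: continuous_cos.
Qed.

Lemma integral_sin k : \int[mu]_t sin (k.+1%:R * t) = 0.
Proof.
pose F (t : R) := - (k.+1%:R)^-1 * cos (k.+1%:R * t).
have dF (t : R) : is_derive t (1 : R) F (sin (k.+1%:R * t)).
  apply: is_derive_eq.
  by rewrite /GRing.scale /= mulr1 !mulNr mulrN opprK mulrCA mulVf ?mulr1.
rewrite (Rintegral_arc_derive _ dF).
  by rewrite /F; have [-> _] := circle2pi_mul k.+1; rewrite mulr0 cos0 subrr.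
by apply: (@continuous_scaled k.+1%:R sin); exact: continuous_sin.
Qed.
End ArcIntegral.

(** * Fourier coefficients *)

Section Fourier.
Context {R : realType}.
Local Notation C := R[i].
Local Notation mu := (@arc_measure R).
Implicit Types f g : C -> C.

Lemma norm_circle_exprz (k : int) (t : R) : `|circle t ^ k| = 1 :> C.
Proof.
by case: k => k; rewrite ?normfV normrX norm_circle expr1n ?invr1.
Qed.

Lemma intT_mul_exprz f (k : int) : intT f -> intT (fun z => f z * z ^ k).
Proof.
move=> intf; apply: intTM_unimodular => //; first exact: measT_exprz.
by move=> t; exact: norm_circle_exprz.
Qed.

Lemma fourierD f g k : intT f -> intT g ->
  fourier (fun z => f z + g z) k = fourier f k + fourier g k.
Proof.
move=> intf intg; rewrite /fourier -mulrDr -integralTD; try exact: intT_mul_exprz.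
by congr (_ * _); apply: integralT_eq => t; rewrite mulrDl.
Qed.

Lemma fourierZ (c : C) f k : intT f -> fourier (fun z => c * f z) k = c * fourier f k.
Proof.
move=> intf; rewrite /fourier mulrCA -(integralTZ c (intT_mul_exprz (- k) intf)).
by congr (_ * _); apply: integralT_eq => t; rewrite mulrA.
Qed.

Lemma fourier_ae f g k : measT f -> measT g -> aeT (fun z => f z = g z) ->
  fourier f k = fourier g k.
Proof.
move=> mf mg fg; congr (_ * _); apply: integralT_ae.
- exact: measTM (measT_exprz _).
- exact: measTM (measT_exprz _).
- by apply: aeT_imp fg => t ->.
Qed.

Lemma fourier_eq f g k : (forall t, f (circle t) = g (circle t)) ->
  fourier f k = fourier g k.
Proof. by move=> fg; congr (_ * _); apply: integralT_eq => t; rewrite fg. Qed.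

Lemma fourier_shift f k : fourier (fun z => z * f z) k = fourier f (k - 1).
Proof.
congr (_ * _); apply: integralT_eq => t.
rewrite mulrAC mulrC opprB addrC expfzDr ?circle_neq0// expr1z.
by rewrite [X in _ * X]mulrC.
Qed.

Lemma integralT_circleX k : integralT (fun z : C => z ^+ k.+1) = 0.
Proof.
apply: complex_ext => /=.
  by under eq_Rintegral do rewrite circleX /=; exact: integral_cos.
by under eq_Rintegral do rewrite circleX /=; exact: integral_sin.
Qed.

Lemma intT_cst (c : C) : intT (fun=> c).
Proof. by split; exact: integrable_arc_cst. Qed.

Lemma fourier_cst (c : C) k : fourier (fun=> c) k = if k == 0 then c else 0.
Proof.
have pi0 : ((2 * pi : R)%:C)%C != 0 :> C.
  by rewrite (inj_eq (@complexI R) _ 0) mulf_neq0 ?gt_eqF ?pi_gt0.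
rewrite /fourier integralTZ; last first.
  by move: (intT_mul_exprz (- k) (intT_cst 1)); under eq_fun do rewrite mul1r.
have -> : integralT (fun z : C => z ^ (- k)) = if k == 0 then ((2 * pi)%:C)%C else 0.
  case: k => [[|k]|k] /=.
  - rewrite (@integralT_eq _ _ (fun=> 1)); last by move=> t; rewrite expr0z.
    by rewrite integralT_cst mul1r.
  - rewrite (@integralT_eq _ _ (fun z => (z ^+ k.+1)^*)); last first.
      by move=> t; rewrite -exprnN rmorphXn /= conj_circle exprVn.
    rewrite integralT_conj ?integralT_circleX ?rmorph0//.
    by move: (intT_mul_exprz k.+1%:Z (intT_cst 1)); under eq_fun do rewrite mul1r.
  - by rewrite NegzE opprK; exact: integralT_circleX.
case: eqP => _; last by rewrite !mulr0.
by rewrite mulrCA -rmorphM /= mulVf ?mulr1// mulf_neq0 ?gt_eqF ?pi_gt0.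
Qed.

Lemma fourier_bound f : intT f -> exists M : R, forall k, `|fourier f k| <= (M%:C)%C.
Proof.
move=> /integralT_unimodular_bound[M hM]; exists ((2 * pi)^-1 * M) => k.
rewrite /fourier normrM rmorphM /= ler_pM//.
  rewrite normc_def /= expr0n addr0 sqrtr_sqr ger0_norm//.
  by rewrite invr_ge0 mulr_ge0// pi_ge0.
apply: hM; first exact: measT_exprz.
by move=> t; exact: norm_circle_exprz.
Qed.

(** Recursions c (k - 1) = b c k between Fourier coefficients are solved by this:
    the coefficients stay bounded, while b ^ k does not. *)
Lemma geometric_bounded_eq0 (b x : C) (M : R) : 1 < `|b| ->
  (forall k, `|b ^+ k * x| <= (M%:C)%C) -> x = 0.
Proof.
have e (y : C) : `|y| = ((complex.Re `|y|)%:C)%C by rewrite RRe_real// normr_real.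
rewrite e => b1 hM; apply/eqP; apply: contrapT => /negP x0.
pose c := complex.Re `|b|; pose d := complex.Re `|x|.
have c1 : 1 < c by rewrite -ltcR.
have d0 : 0 < d by rewrite -ltcR -e normr_gt0.
have h k : c ^+ k * d <= M.
  by have := hM k; rewrite normrM normrX (e b) (e x) -rmorphXn -rmorphM lecR.
have hk k : 1 + (c - 1) *+ k <= c ^+ k.
  elim: k => [|k IH]; first by rewrite mulr0n addr0 expr0.
  have ck : 1 <= c ^+ k by rewrite exprn_ege1// ltW.
  by rewrite exprS mulrSr; nra.
have [k] : exists k : nat, M / d < (c - 1) *+ k.
  exists (Num.Def.archi_bound (M / d / (c - 1))).
  rewrite -mulr_natr [ltRHS]mulrC -ltr_pdivrMr ?subr_gt0//.
  have M0 : 0 <= M by rewrite (le_trans _ (h 0))// expr0 mul1r ltW.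
  by rewrite archi_boundP// !divr_ge0 ?(ltW d0)// subr_ge0 ltW.
rewrite ltr_pdivrMr// => hk'.
have := h k; have := hk k; nra.
Qed.

End Fourier.

(** * Hardy spaces and rational functions without poles in the disc *)

Section Hardy.
Context {R : realType}.
Local Notation C := R[i].
Implicit Types f g : C -> C.

Lemma L2_ge1 : (1 <= 2%:E :> \bar R)%E.
Proof. by rewrite lee1n. Qed.
Hint Resolve L2_ge1 : core.

Lemma LpT_bounded f (M : R) : measT f -> aeT (fun z => `|f z| <= (M%:C)%C) ->
  LpT 2%:E f.
Proof.
move=> mf hM; apply: (@LpT_subset _ _ +oo%E) => //; first by rewrite leey.
  by rewrite leey.
by apply/LpT_ooP; split=> //; exists M.
Qed.

Lemma H2_cst (c : C) : HpT 2%:E (fun=> c).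
Proof.
split; last by move=> k k0; rewrite fourier_cst lt_eqF.
apply: (@LpT_bounded _ (complex.Re `|c|)); first exact: measT_cst.
by apply: aeT_all => t; rewrite RRe_real// normr_real.
Qed.

Lemma H2_int f : HpT 2%:E f -> intT f.
Proof. by case=> /LpT_int + _; apply. Qed.

Lemma H2D f g : HpT 2%:E f -> HpT 2%:E g -> HpT 2%:E (fun z => f z + g z).
Proof.
move=> hf hg; split; first by apply: LpTD => //; [case: hf | case: hg].
move=> k k0; rewrite fourierD; try exact: H2_int.
by case: hf hg => _ -> // [_ ->] //; rewrite addr0.
Qed.

Lemma H2_shift f : HpT 2%:E f -> HpT 2%:E (fun z => z * f z).
Proof.
move=> [lf hf]; split.
  apply: (@LpT2M_bounded _ id f 1) => //; first exact: measT_id.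
  by move=> t; rewrite norm_circle.
move=> k k0; rewrite fourier_shift hf//.
by rewrite (lt_trans _ k0)// ltrBlDr ltrDl.
Qed.

Lemma H2Z (c : C) f : HpT 2%:E f -> HpT 2%:E (fun z => c * f z).
Proof.
move=> hf; split.
  apply: (@LpT2M_bounded _ (fun=> c) f (complex.Re `|c|)); first exact: measT_cst.
    by move=> t; rewrite RRe_real// normr_real.
  by case: hf.
move=> k k0; rewrite fourierZ; last exact: H2_int.
by case: hf => _ ->//; rewrite mulr0.
Qed.

Lemma HpT_eq p f g : (forall t, f (circle t) = g (circle t)) -> HpT p f -> HpT p g.
Proof.
move=> fg [[lr li] hf]; split; last by move=> k k0; rewrite -(fourier_eq _ fg) hf.
by split; [under eq_fun do rewrite -fg | under eq_fun do rewrite -fg].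
Qed.

Lemma H2_horner (p : {poly C}) f : HpT 2%:E f -> HpT 2%:E (fun z => p.[z] * f z).
Proof.
move=> hf; elim/poly_ind: p => [|p c IH].
  by under eq_fun do rewrite horner0 mul0r; exact: H2_cst.
apply: (@HpT_eq _ (fun z => z * (p.[z] * f z) + c * f z)).
  by move=> t; rewrite !hornerE /=; ring.
by apply: H2D; [exact: H2_shift | exact: H2Z].
Qed.

Lemma norm_circle_sub (b : C) t : `|b| - 1 <= `|circle t - b|.
Proof. by rewrite -(norm_circle t) distrC lerB_dist. Qed.

Lemma invf_bounded (b : C) : 1 < `|b| -> exists M : R, forall t,
  `|(circle t - b)^-1| <= (M%:C)%C.
Proof.
move=> b1; exists (complex.Re (`|b| - 1)^-1) => t.
have b0 : 0 < `|b| - 1 by rewrite subr_gt0.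
rewrite RRe_real; last by rewrite realV gtr0_real.
by rewrite normfV lef_pV2 ?posrE// ?norm_circle_sub// (lt_le_trans b0)// norm_circle_sub.
Qed.

Lemma measT_subV (b : C) : measT (fun z => (z - b)^-1).
Proof.
by apply: (@measTV _ (fun z => z - b)); apply: measTD; [exact: measT_id | exact: measT_cst].
Qed.

Lemma circle_sub_neq0 (b : C) t : 1 < `|b| -> circle t - b != 0.
Proof.
move=> b1; rewrite subr_eq0; apply: contraTneq b1 => <-.
by rewrite norm_circle ltxx.
Qed.

(** The Fourier coefficients of h = f / (z - b) satisfy h(k - 1) = b h(k) for
    k < 0, because those of f vanish; being bounded, they vanish too. *)
Lemma H2_div (b : C) f : 1 < `|b| -> HpT 2%:E f ->
  HpT 2%:E (fun z => (z - b)^-1 * f z).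
Proof.
move=> b1 hf; have [M hM] := invf_bounded b1.
have lh : LpT 2%:E (fun z => (z - b)^-1 * f z).
  apply: (LpT2M_bounded _ hM); first exact: measT_subV.
  by case: hf.
split=> //; set h := fun z => _.
have ih : intT h by exact: LpT_int lh.
have iz : intT (fun z => z * h z).
  apply: (@LpT_int _ 2%:E) => //; apply: (@LpT2M_bounded _ id h 1) => //.
    exact: measT_id.
  by move=> t; rewrite norm_circle.
have rec (k : int) : k < 0 -> fourier h (k - 1) = b * fourier h k.
  move=> k0; apply/eqP; rewrite -subr_eq0; apply/eqP.
  rewrite -fourier_shift -mulNr -fourierZ// -fourierD//; last exact: intTZ.
  rewrite (@fourier_eq _ _ f); first by case: hf => _ ->.
  by move=> t; rewrite -mulrDl mulrA mulfV ?mul1r// circle_sub_neq0.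
have rec' (n m : nat) : fourier h (- (n + m).+1%:Z) = b ^+ m * fourier h (- n.+1%:Z).
  elim: m => [|m IH]; first by rewrite addn0 mul1r.
  rewrite exprS -mulrA -IH -rec// addnS; congr (fourier h _).
  by rewrite -[in LHS]addn1 PoszD opprD.
have [N hN] := fourier_bound ih.
move=> [//|n] _; rewrite NegzE.
apply: (@geometric_bounded_eq0 _ b _ N) => // m.
by rewrite -rec'.
Qed.

End Hardy.

Section Regular.
Context {R : realType}.
Local Notation C := R[i].
Implicit Types f g : C -> C.

(** Rational functions without poles in the closed unit disc, identified by their
    values in the disc; they are the analytic functions of this proof, and their
    pointwise values inside the disc carry the arguments about zeros. *)
Definition regular f := exists p q : {poly C},
  (forall z, `|z| <= 1 -> q.[z] != 0) /\ (forall z, `|z| <= 1 -> f z = p.[z] / q.[z]).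

Lemma regular_eq f g : (forall z, `|z| <= 1 -> f z = g z) -> regular f -> regular g.
Proof. by move=> fg [p [q [q0 fE]]]; exists p, q; split=> // z z1; rewrite -fg// fE. Qed.

Lemma regular_poly (p : {poly C}) : regular (fun z => p.[z]).
Proof.
by exists p, 1; split=> z _; rewrite hornerC ?oner_neq0// divr1.
Qed.

Lemma regular_cst (c : C) : regular (fun=> c).
Proof. by apply: regular_eq (regular_poly c%:P) => z _; rewrite hornerC. Qed.

Lemma regular_id : regular id.
Proof. by apply: regular_eq (regular_poly 'X) => z _; rewrite hornerX. Qed.

Lemma regularD f g : regular f -> regular g -> regular (fun z => f z + g z).
Proof.
move=> [p [q [q0 fE]]] [p' [q' [q0' gE]]].
exists (p * q' + p' * q), (q * q'); split=> z z1.
  by rewrite hornerM mulf_neq0 ?q0 ?q0'.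
by rewrite fE// gE// !hornerE addf_div ?q0 ?q0'.
Qed.

Lemma regularM f g : regular f -> regular g -> regular (fun z => f z * g z).
Proof.
move=> [p [q [q0 fE]]] [p' [q' [q0' gE]]].
exists (p * p'), (q * q'); split=> z z1.
  by rewrite hornerM mulf_neq0 ?q0 ?q0'.
by rewrite fE// gE// !hornerM mulf_div.
Qed.

Lemma regularV f : (forall z, `|z| <= 1 -> f z != 0) -> regular f ->
  regular (fun z => (f z)^-1).
Proof.
move=> f0 [p [q [q0 fE]]]; exists q, p; split=> z z1.
  by apply: contra_neq (f0 z z1) => pz; rewrite fE// pz mul0r.
by rewrite fE// invf_div.
Qed.

Lemma regular_sum (I : Type) (r : seq I) (P : pred I) (F : I -> C -> C) :
  (forall i, regular (F i)) -> regular (fun z => \sum_(i <- r | P i) F i z).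
Proof.
move=> rF; elim: r => [|i r IH].
  by under eq_fun do rewrite big_nil; exact: regular_cst.
under eq_fun do rewrite big_cons; case: (P i) => //.
exact: regularD.
Qed.

Lemma regular_prod (I : eqType) (r : seq I) (F : I -> C -> C) :
  (forall i, i \in r -> regular (F i)) -> regular (fun z => \prod_(i <- r) F i z).
Proof.
elim: r => [|i r IH] rF.
  by under eq_fun do rewrite big_nil; exact: regular_cst.
under eq_fun do rewrite big_cons; apply: regularM; first by apply: rF; rewrite mem_head.
by apply: IH => j jr; apply: rF; rewrite in_cons jr orbT.
Qed.

Lemma regular_horner_comp (p : {poly C}) g : regular g -> regular (fun z => p.[g z]).
Proof.
move=> rg; elim/poly_ind: p => [|p c IH].
  by under eq_fun do rewrite horner0; exact: regular_cst.
under eq_fun do rewrite !hornerE.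
by apply: regularD; [exact: regularM | exact: regular_cst].
Qed.

Lemma regular_comp f g : regular f -> regular g -> (forall z, `|z| <= 1 -> `|g z| <= 1) ->
  regular (fun z => f (g z)).
Proof.
move=> [p [q [q0 fE]]] rg g1.
apply: (@regular_eq (fun z => p.[g z] * (q.[g z])^-1)).
  by move=> z z1; rewrite fE ?g1.
apply: regularM; first exact: regular_horner_comp.
apply: regularV; last exact: regular_horner_comp.
by move=> z z1; rewrite q0 ?g1.
Qed.

Lemma regular_factor f (a : C) : `|a| <= 1 -> regular f -> f a = 0 ->
  exists2 g, regular g & forall z, `|z| <= 1 -> f z = (z - a) * g z.
Proof.
move=> a1 [p [q [q0 fE]]] fa.
have /factor_theorem[p' p'E] : root p a.
  by move/eqP: fa; rewrite fE// mulf_eq0 invr_eq0 (negbTE (q0 a a1)) orbF.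
exists (fun z => p'.[z] / q.[z]); first by exists p', q.
by move=> z z1; rewrite fE// p'E !hornerE /= mulrAC mulrC mulrA.
Qed.

(** A function without poles in the closed disc is a polynomial divided by
    factors z - b with |b| > 1, so a class of functions on the circle stable under
    polynomial multiples and such divisions is stable under regular multiples. *)
Lemma regular_mul_ind (P : (C -> C) -> Prop) :
  (forall f g, (forall t, f (circle t) = g (circle t)) -> P f -> P g) ->
  (forall (p : {poly C}) f, P f -> P (fun z => p.[z] * f z)) ->
  (forall b f, 1 < `|b| -> P f -> P (fun z => (z - b)^-1 * f z)) ->
  forall f g, regular f -> P g -> P (fun z => f z * g z).
Proof.
move=> Peq Ppoly Pdiv f g [p [q [q0 fE]]] hg.
have c1 t : `|circle t : C| <= 1 by rewrite norm_circle.
apply: (Peq (fun z => (q.[z])^-1 * (p.[z] * g z))).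
  by move=> t; rewrite fE//; ring.
have hpg := Ppoly p _ hg.
have [r qE] := closed_field_poly_normal q.
have r0 b : b \in r -> 1 < `|b|.
  move=> br; rewrite real_ltNge ?normr_real ?real1//; apply/negP => /q0/eqP; apply.
  rewrite qE hornerZ; have -> : (\prod_(z <- r) ('X - z%:P)).[b] = 0; last by rewrite mulr0.
  by apply/eqP; rewrite -/(root _ _) root_prod_XsubC.
apply: (Peq (fun z => ((lead_coef q)^-1)%:P.[z] *
    ((\prod_(b <- r) ('X - b%:P)).[z]^-1 * (p.[z] * g z)))).
  by move=> t; rewrite [in RHS]qE hornerZ hornerC invfM -mulrA.
apply: Ppoly => {qE q0 fE q}.
elim: r r0 => [|b r IH] r0.
  by apply: Peq hpg => t; rewrite big_nil hornerC invr1 mul1r.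
apply: (Peq (fun z => (z - b)^-1 * (((\prod_(b <- r) ('X - b%:P)).[z])^-1 * (p.[z] * g z)))).
  by move=> t; rewrite big_cons hornerM hornerXsubC invfM mulrA.
apply: Pdiv; first by apply: r0; rewrite mem_head.
by apply: IH => c cr; apply: r0; rewrite in_cons cr orbT.
Qed.

Lemma regularM_H2 f g : regular f -> HpT 2%:E g -> HpT 2%:E (fun z => f z * g z).
Proof.
apply: (@regular_mul_ind (HpT 2%:E)); [exact: HpT_eq | exact: H2_horner |].
by move=> b h b1; exact: H2_div.
Qed.

Lemma regular_H2 f : regular f -> HpT 2%:E f.
Proof.
move=> rf; apply: HpT_eq (regularM_H2 rf (H2_cst 1)) => t.
by rewrite mulr1.
Qed.

Lemma regular_measT f : regular f -> measT f.
Proof. by move=> /regular_H2[/LpT_measT]. Qed.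

Lemma regular_bounded f : regular f -> exists M : R, forall t, `|f (circle t)| <= (M%:C)%C.
Proof.
pose P f := exists M : R, forall t, `|f (circle t)| <= (M%:C)%C.
have PM u v : P u -> P v -> P (fun z => u z * v z).
  move=> [M hM] [N hN]; exists (M * N) => t.
  by rewrite normrM rmorphM ler_pM.
have Pc (c : C) : P (fun=> c).
  by exists (complex.Re `|c|) => t; rewrite RRe_real// normr_real.
have Pp (p : {poly C}) : P (fun z => p.[z]).
  elim/poly_ind: p => [|p c [M hM]]; first by under eq_fun do rewrite horner0; exact: Pc.
  have [N hN] := Pc c; exists (M + N) => t; rewrite !hornerE rmorphD.
  by rewrite (le_trans (ler_normD _ _))// lerD ?(hN 0)// normrM norm_circle mulr1.
have Peq u v : (forall t, u (circle t) = v (circle t)) -> P u -> P v.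
  by move=> uv [M hM]; exists M => t; rewrite -uv.
move=> rf; apply: (Peq (fun z => f z * 1)); first by move=> t; rewrite mulr1.
apply: regular_mul_ind rf (Pc 1) => // [p u|b u b1]; apply: PM => //.
exact: invf_bounded.
Qed.

Lemma regular_Hoo f : regular f -> HpT +oo%E f.
Proof.
move=> rf; have [_ hf] := regular_H2 rf; split=> //.
apply/LpT_ooP; split; first exact: regular_measT.
by have [M hM] := regular_bounded rf; exists M; exact: aeT_all.
Qed.

(** The mean value property: f = f 0 + z g with g in H2, and the coefficient of index 0
    of z g is the one of index -1 of g. *)
Lemma regular_fourier0 f : regular f -> fourier f 0 = f 0.
Proof.
move=> rf.
have [g rg gE] : exists2 g, regular g & forall z, `|z| <= 1 -> f z - f 0 = (z - 0) * g z.
  apply: regular_factor; rewrite ?normr0 ?subrr//.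
  by apply: regularD => //; exact: regular_cst.
rewrite (@fourier_eq _ _ (fun z => z * g z + f 0)); last first.
  by move=> t; move: (gE (circle t)); rewrite norm_circle subr0 => <- //; rewrite subrK.
rewrite fourierD; last exact: intT_cst.
  rewrite fourier_shift fourier_cst eqxx sub0r.
  by have [_ ->] := regular_H2 rg; rewrite ?add0r.
by apply: H2_int; apply: H2_shift; exact: regular_H2.
Qed.
End Regular.

(** * Uniqueness of Fourier coefficients *)

Section FourierUniqueness.
Context {R : realType}.
Local Notation C := R[i].
Local Notation mu := (@arc_measure R).
Implicit Types f g : C -> C.

Lemma integral_Rintegral0 (v : R -> R) : mu.-integrable setT (EFin \o v) ->
  \int[mu]_t v t = 0 -> (\int[mu]_t (v t)%:E = 0)%E.
Proof.
move=> iv; rewrite /Rintegral => e; have := integrable_fin_num measurableT iv.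
by move=> /fineK; rewrite e => <-.
Qed.

Lemma circle_cos (t : R) (k : nat) :
  circle t ^ k%:Z + circle t ^ (- k%:Z) = ((2 * cos (k%:R * t))%:C)%C :> C.
Proof.
rewrite -exprnP -exprnN -exprVn -conj_circle -rmorphXn /= circleX.
apply: complex_ext; rewrite ?Re_add ?Im_add ?Re_conjC ?Im_conjC /=; ring.
Qed.

Lemma circle_sin (t : R) (k : nat) :
  circle t ^ k%:Z - circle t ^ (- k%:Z) = ((2 * sin (k%:R * t))%:C)%C * 'i%C :> C.
Proof.
rewrite -exprnP -exprnN -exprVn -conj_circle -rmorphXn /= circleX.
set x := k%:R * t; rewrite -[- _]/(- (circle x)^*).
by apply: complex_ext => /=; ring.
Qed.

Lemma ae_itvoo : \forall t \ae mu, t \in (`]0, 2 * pi[%classic : set R).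
Proof.
exists (~` `]0, 2 * pi[%classic); split.
- exact: measurableC.
- rewrite /arc_measure /= /mrestr.
  rewrite (_ : _ `&` _ = [set 0] `|` [set 2 * pi]); last first.
    rewrite predeqE => t /=; rewrite !in_itv/=; split.
      move=> [/negP h1 h2]; move: h1; rewrite negb_and -!leNgt => h1.
      have /andP[h4 h5] := h2.
      by have /orP[h3|h3] := h1; [left|right]; apply/eqP; rewrite eq_le ?h3 ?h4 ?h5.
    have pi0 : 0 <= 2 * pi :> R by rewrite mulr_ge0 ?pi_ge0.
    by move=> [->|->]; rewrite ?ltxx ?andbF ?lexx pi0.
  apply/eqP; rewrite -measure_le0 (le_trans (measureU2 _ _ _))//.
  have l1 (a : R) : (lebesgue_measure [set a] <= 0)%E by rewrite lebesgue_measure_set1.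
  by rewrite -[leRHS]adde0; exact: (leeD (l1 _) (l1 _)).
- by move=> t /= /negP; rewrite notin_setE.
Qed.

Lemma ae_eq0_trig (g : R -> R) : mu.-integrable setT (EFin \o g) ->
  (forall k : nat, \int[mu]_t (g t * cos (k%:R * t)) = 0) ->
  (forall k : nat, \int[mu]_t (g t * sin (k%:R * t)) = 0) ->
  \forall t \ae mu, g t = 0.
Proof.
move=> ig hc hs.
have m0 : measurable_fun setT (fun _ : R => 0 : R) by exact: measurable_cst.
have t0 (t : R) : 0 <= (0 : R) <= 2 * pi by rewrite lexx mulr_ge0 ?pi_ge0.
have bnd (h : R -> R) : measurable_fun setT h -> (forall t, `|h t| <= 1) ->
    \int[mu]_t (g t * h t) = 0 -> annihilated 0 (fun=> 0) g h.
  move=> mh h1 ih; split=> //; first by exists 1.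
  apply: integral_Rintegral0.
    by apply: integrable_pairing => //; exists 1.
  rewrite -[RHS]ih; apply: eq_Rintegral => t _.
  by rewrite /pairing mul0r add0r mulrC.
have mc (k : nat) (h : R -> R) : continuous h -> measurable_fun setT (fun t : R => h (k%:R * t)).
  by move=> ch; apply: continuous_measurable_fun; exact: continuous_scaled.
have B := @annihilated_borel _ 0 (fun=> 0) g m0 t0 ig.
have {}B (E : set R) : measurable E -> annihilated 0 (fun=> 0) g (\1_(E `&` `]0, 2 * pi[)).
  apply: B => k; apply: bnd => //.
  - by apply: mc; exact: continuous_cos.
  - by move=> t; rewrite ler_norml cos_geN1 cos_le1.
  - by apply: mc; exact: continuous_sin.
  - by move=> t; rewrite ler_norml sin_geN1 sin_le1.
have mI : measurable (`]0, 2 * pi[%classic : set R) by exact: measurable_itv.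
have : ae_eq mu (`]0, 2 * pi[%classic : set R) (EFin \o g) (cst 0%E).
  apply: integral_ae_eq => //.
    by apply: integrableS ig.
  move=> E ED mE; rewrite integral_cst// mul0e.
  have [_ _ <-] := B E mE.
  rewrite integral_mkcond; apply: eq_integral => t _.
  rewrite /pairing mul0r add0r patchE indicE (setIidl ED).
  by case: (t \in E); rewrite ?mul1r ?mul0r.
move=> h.
apply: (@filterS2 _ _ (ae_filter_ringOfSetsType mu)) h ae_itvoo => t /= h1 h2.
by apply: EFin_inj; apply: h1; rewrite inE in h2.
Qed.

Lemma fourier_eq0 f : intT f -> (forall k, fourier f k = 0) -> aeT (fun z => f z = 0).
Proof.
move=> intf f0; have [fr fi] := intf.
have pi0 : ((2 * pi)^-1%:C)%C != 0 :> C.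
  by rewrite (inj_eq (@complexI R) _ 0) invr_eq0 mulf_neq0 ?gt_eqF ?pi_gt0.
have I0 (k : int) : integralT (fun z => f z * z ^ k) = 0.
  apply/eqP; have /eqP := f0 (- k); rewrite /fourier opprK mulf_eq0.
  by rewrite (negbTE pi0).
have IC (k : nat) : integralT (fun z => f z * ((z ^ k%:Z) + z ^ (- k%:Z))) = 0.
  rewrite (@integralT_eq _ _ (fun z => f z * z ^ k%:Z + f z * z ^ (- k%:Z))).
    by rewrite integralTD ?I0 ?addr0//; exact: intT_mul_exprz.
  by move=> t; rewrite mulrDr.
have IS (k : nat) : integralT (fun z => - 'i%C * (f z * z ^ k%:Z - f z * z ^ (- k%:Z))) = 0.
  rewrite (@integralT_eq _ _ (fun z => (- 'i%C) * (f z * z ^ k%:Z) + 'i%C * (f z * z ^ (- k%:Z)))).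
    rewrite integralTD; [|by apply: intTZ; exact: intT_mul_exprz..].
    by rewrite !integralTZ ?I0 ?mulr0 ?addr0//; exact: intT_mul_exprz.
  by move=> t; ring.
have ec k t : f (circle t) * (circle t ^ k%:Z + circle t ^ (- k%:Z)) =
    ((2 * cos (k%:R * t))%:C)%C * f (circle t) by rewrite circle_cos mulrC.
have es k t : - 'i%C * (f (circle t) * circle t ^ k%:Z - f (circle t) * circle t ^ (- k%:Z)) =
    ((2 * sin (k%:R * t))%:C)%C * f (circle t).
  rewrite -mulrBr circle_sin; have := sqr_i R; rewrite expr2 => ii.
  transitivity (- ('i%C * 'i%C) * ((2 * sin (k%:R * t))%:C)%C * f (circle t)); first by ring.
  by rewrite ii opprK mul1r.
have R0 (p : R -> R) (v : R -> R) : mu.-integrable setT (EFin \o (fun t => v t * p t)) ->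
    \int[mu]_t (2 * p t * v t) = 0 -> \int[mu]_t (v t * p t) = 0.
  move=> iv; under eq_Rintegral do rewrite -mulrA [_ * v _]mulrC.
  by rewrite RintegralZl// => /eqP; rewrite mulf_eq0 pnatr_eq0 => /eqP.
have im (p v : R -> R) : continuous p -> (forall t, `|p t| <= 1) ->
    mu.-integrable setT (EFin \o v) -> mu.-integrable setT (EFin \o (fun t => v t * p t)).
  move=> cp p1 iv; have mv := measurable_int _ iv; apply: le_integrable iv => //.
    apply/measurable_EFinP; apply: measurable_funM; last exact: continuous_measurable_fun.
    exact/measurable_EFinP.
  by move=> t _; rewrite /= lee_fin normrM ler_piMr.
have cosb (k : nat) (t : R) : `|cos (k%:R * t)| <= 1 by rewrite ler_norml cos_geN1 cos_le1.
have sinb (k : nat) (t : R) : `|sin (k%:R * t)| <= 1 by rewrite ler_norml sin_geN1 sin_le1.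
have ccos (k : nat) : continuous (fun t : R => cos (k%:R * t)).
  by apply: (@continuous_scaled _ k%:R cos); exact: continuous_cos.
have csin (k : nat) : continuous (fun t : R => sin (k%:R * t)).
  by apply: (@continuous_scaled _ k%:R sin); exact: continuous_sin.
have hr : aeT (fun z => complex.Re (f z) = 0).
  apply: (@ae_eq0_trig (fun t => complex.Re (f (circle t)))) => // k.
    apply: R0; first exact: im.
    have /(congr1 (@complex.Re R)) := IC k; rewrite /integralT /= => <-.
    by apply: eq_Rintegral => t _; rewrite ec Re_mul /= mul0r subr0.
  apply: R0; first exact: im.
  have /(congr1 (@complex.Re R)) := IS k; rewrite /integralT [RHS]/= => <-.
  by apply: eq_Rintegral => t _; rewrite es Re_mul Re_real Im_real mul0r subr0.
have hi : aeT (fun z => complex.Im (f z) = 0).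
  apply: (@ae_eq0_trig (fun t => complex.Im (f (circle t)))) => // k.
    apply: R0; first exact: im.
    have /(congr1 (@complex.Im R)) := IC k; rewrite /integralT [RHS]/= => <-.
    by apply: eq_Rintegral => t _; rewrite ec Im_mul Re_real Im_real mul0r addr0.
  apply: R0; first exact: im.
  have /(congr1 (@complex.Im R)) := IS k; rewrite /integralT [RHS]/= => <-.
  by apply: eq_Rintegral => t _; rewrite es Im_mul Re_real Im_real mul0r addr0.
by apply: aeT_imp (aeT_and hr hi) => t [h1 h2]; exact: complex_ext.
Qed.

Lemma fourier_conj f k : intT f -> fourier (fun z => (f z)^*) k = (fourier f (- k))^*.
Proof.
move=> intf; rewrite /fourier opprK rmorphM /=; congr (_ * _).
  by rewrite conjC_conjc conjc_real.
rewrite -integralT_conj; last exact: intT_mul_exprz.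
apply: integralT_eq => t; rewrite rmorphM /=; congr (_ * _).
case: k => k; first by rewrite -exprnN -exprnP rmorphXn /= conj_circle exprVn.
by rewrite NegzE opprK -exprnN -exprnP fmorphV rmorphXn /= conj_circle exprVn invrK.
Qed.

(** The coefficients of negative index vanish for f, those of positive index for the
    conjugate of f. *)
Lemma H2_conj_constant f : HpT 2%:E f -> HpT 2%:E (fun z => (f z)^*) ->
  aeT (fun z => f z = fourier f 0).
Proof.
move=> hf [_ hc].
have intf := H2_int hf.
have intc := intT_cst (- fourier f 0).
have : aeT (fun z => f z + - fourier f 0 = 0).
  apply: fourier_eq0 => [|k]; first exact: intTD.
  rewrite fourierD// fourier_cst; case: (ltrgtP k 0) => [k0|k0|->].
  - by rewrite addr0; case: hf => _ ->.
  - rewrite addr0; have := hc (- k); rewrite oppr_lt0 fourier_conj// opprK.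
    by move=> /(_ k0)/eqP; rewrite fmorph_eq0 => /eqP.
  - by rewrite subrr.
by apply: aeT_imp => t /eqP; rewrite subr_eq0 => /eqP.
Qed.

End FourierUniqueness.

(** * Inner functions preserve null sets *)

Section Angle.
Context {R : realType}.
Local Notation C := R[i].

(** A measurable choice of the argument in [0, 2 pi]: it turns a self-map of the circle
    into a self-map of [0, 2 pi]. *)
Definition angle (z : C) : R :=
  if 0 <= complex.Im z then acos (complex.Re z) else 2 * pi - acos (complex.Re z).

Lemma norm1_Re (z : C) : `|z| = 1 -> -1 <= complex.Re z <= 1.
Proof. by move=> z1; rewrite -ler_norml; apply: norm_Re_le; rewrite z1. Qed.

Lemma angle_bound (z : C) : `|z| = 1 -> 0 <= angle z <= 2 * pi.
Proof.
move=> /norm1_Re z1; rewrite /angle.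
have h1 := acos_ge0 z1; have h2 := acos_lepi z1; have pi0 := pi_gt0 R.
by case: ifP => _; lra.
Qed.

Lemma circle_angle (z : C) : `|z| = 1 -> circle (angle z) = z.
Proof.
move=> z1; have x1 := norm1_Re z1.
have xy : 1 - complex.Re z ^+ 2 = complex.Im z ^+ 2.
  have := add_Re2_Im2 z; rewrite z1 expr1n => /(congr1 (@complex.Re R)) /= <-.
  by rewrite addrC addKr.
have ca : cos (acos (complex.Re z)) = complex.Re z by rewrite acosK// in_itv.
have sa : sin (acos (complex.Re z)) = `|complex.Im z| by rewrite sin_acos// xy sqrtr_sqr.
rewrite /angle; case: ifPn => y0.
  by apply: complex_ext; rewrite /= ?ca ?sa// ger0_norm.
have p2 : 2 * pi = pi *+ 2 :> R by rewrite mulr_natl.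
apply: complex_ext; rewrite /= ?cosB ?sinB p2 cos2pi sin2pi ?ca ?sa.
  by rewrite mul1r mul0r addr0.
by rewrite mul1r mul0r sub0r ltr0_norm ?opprK// ltNge.
Qed.

(** acos is continuous in the open interval only, which suffices for measurability. *)
Lemma measurable_acos : measurable_fun (`[-1, 1]%classic : set R) (@acos R).
Proof.
apply: (@measurable_fun_itv_cc _ _ _ false true).
apply: open_continuous_measurable_fun; first exact: interval_open.
by move=> x; rewrite inE/= in_itv/=; exact: continuous_acos.
Qed.

Lemma measurable_angle (w : C -> C) : measT w -> (forall t, `|w (circle t)| = 1) ->
  measurable_fun setT (fun t => angle (w (circle t))).
Proof.
move=> [mr mi] w1.
have ma : measurable_fun setT (fun t => acos (complex.Re (w (circle t)))).
  apply: (measurable_comp _ _ measurable_acos mr); first exact: measurable_itv.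
  by move=> _ [t _ <-] /=; rewrite in_itv/= norm1_Re.
apply: measurable_fun_ifT => //.
  by apply: measurable_fun_ler => //; exact: measurable_cst.
by apply: measurable_funB => //; exact: measurable_cst.
Qed.
End Angle.

Section Nonsingular.
Context {R : realType}.
Local Notation C := R[i].
Local Notation mu := (@arc_measure R).

(** The Poisson kernel (1 - |a| ^ 2) / |z - a| ^ 2 on the circle, in the form
    2 Re (1 / (1 - conj a z)) - 1, which shows its Fourier coefficients. *)
Definition poisson (a : C) (z : C) : C :=
  (1 - a^* * z)^-1 + ((1 - a^* * z)^-1)^* - 1.

Variable a : C.
Hypothesis a1 : `|a| < 1.

Lemma cauchy_neq0 (z : C) : `|z| <= 1 -> 1 - a^* * z != 0.
Proof.
move=> z1; rewrite subr_eq0; apply/eqP => e.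
have : `|a^* * z| < 1.
  by rewrite normrM norm_conjC (le_lt_trans _ a1)// ler_piMr.
by rewrite -e normr1 ltxx.
Qed.

Lemma regular_cauchy : regular (fun z => (1 - a^* * z)^-1).
Proof.
apply: regularV; first exact: cauchy_neq0.
apply: (@regular_eq _ (fun z => 1 + - a^* * z)); first by move=> z _; rewrite mulNr.
apply: regularD; first exact: regular_cst.
by apply: regularM; [exact: regular_cst | exact: regular_id].
Qed.

(** These are the coefficients of the geometric series of ratio conj a z, read off
    f = 1 + conj a z f rather than from a convergent expansion. *)
Lemma fourier_cauchy (k : nat) : fourier (fun z => (1 - a^* * z)^-1) k%:Z = a^* ^+ k.
Proof.
set f := fun z => _; have rf : regular f := regular_cauchy.
have intf := H2_int (regular_H2 rf).
elim: k => [|k IH]; first by rewrite regular_fourier0// /f mulr0 subr0 invr1.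
have e : fourier f k.+1 = fourier (fun z => a^* * (z * f z) + 1) k.+1.
  apply: fourier_eq => t.
  have q0 := @cauchy_neq0 (circle t); rewrite norm_circle in q0.
  by have {}q0 := q0 (lexx _); rewrite /f; field.
rewrite e fourierD; last exact: intT_cst.
  rewrite fourierZ ?fourier_cst ?fourier_shift; last by apply: H2_int; apply: H2_shift; exact: regular_H2.
  by rewrite addr0 exprS -IH; congr (_ * fourier f _); rewrite -addn1 PoszD addrK.
apply: intTZ; apply: H2_int; apply: H2_shift; exact: regular_H2.
Qed.

Lemma fourier_poisson (k : nat) : fourier (poisson a) (- k%:Z) = a ^+ k.
Proof.
have intf := H2_int (regular_H2 regular_cauchy).
have intg : intT (fun z => ((1 - a^* * z)^-1)^*).
  by case: intf => ir ii; split; [under eq_fun do rewrite Re_conjC | under eq_fun do rewrite Im_conjC EFinN; exact: integrableN].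
rewrite /poisson fourierD; [|exact: intTD|exact: intT_cst].
rewrite fourierD// fourier_conj// opprK fourier_cauchy rmorphXn /= conjCK fourier_cst.
have -> : fourier (fun z => (1 - a^* * z)^-1) (- k%:Z) = if - k%:Z == 0 then 1 else 0.
  case: k => [|k]; first by rewrite oppr0 eqxx (fourier_cauchy 0).
  by have [_ ->] := regular_H2 regular_cauchy; rewrite ?oppr_lt0// oppr_eq0.
by case: ifP => _; ring.
Qed.

Lemma poisson_real t : complex.Im (poisson a (circle t)) = 0.
Proof. by rewrite /poisson !Im_add Im_conjC subrr /= subrr. Qed.

Variable w : C -> C.
Hypothesis rw : regular w.
Hypothesis w1 : forall t, `|w (circle t)| = 1.
Hypothesis w0 : w 0 = a.

Lemma integralT_fourier (f : C -> C) (k : int) :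
  integralT (fun z => f z * z ^ k) = ((2 * pi)%:C)%C * fourier f (- k).
Proof.
rewrite /fourier opprK mulrA -rmorphM /= divff ?mul1r//.
by rewrite mulf_neq0 ?gt_eqF ?pi_gt0.
Qed.

(** The image of arc length under w has density the Poisson kernel at w 0: by the
    mean value property both have the moments 2 pi (w 0) ^ k. *)
Lemma integralT_moment (k : nat) :
  integralT (fun z => w z ^+ k) = integralT (fun z => poisson a z * z ^ k%:Z).
Proof.
rewrite integralT_fourier fourier_poisson -w0.
have rwk : regular (fun z => w z ^+ k).
  apply: (@regular_eq _ (fun z => ('X^k).[w z])); first by move=> z _; rewrite hornerXn.
  exact: regular_horner_comp.
rewrite (@integralT_eq _ _ (fun z => w z ^+ k * z ^ 0)); last by move=> t; rewrite expr0z mulr1.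
by rewrite integralT_fourier oppr0 regular_fourier0.
Qed.

Let tau (t : R) := angle (w (circle t)).
Let g (t : R) := - complex.Re (poisson a (circle t)).

Lemma integrable_poisson : mu.-integrable setT (EFin \o g).
Proof.
have [ir _] := H2_int (regular_H2 regular_cauchy).
have -> : EFin \o g = (fun t => (- 2)%:E * (complex.Re (1 - a^* * circle t)^-1)%:E + 1%:E)%E.
  apply/funext => t; rewrite /g /poisson /= !Re_add Re_conjC -EFinM -EFinD.
  by congr EFin; rewrite [complex.Re (- 1)]/=; ring.
by apply: integrableD => //; [exact: integrableZl | exact: integrable_arc_cst].
Qed.

Let mtau : measurable_fun setT tau.
Proof. by apply: measurable_angle => //; exact: regular_measT. Qed.

Let tauD t : 0 <= tau t <= 2 * pi.
Proof. exact: angle_bound. Qed.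

Let moment (k : nat) : integralT (fun z => w z ^+ k + - 1 * (poisson a z * z ^+ k)) = 0.
Proof.
have iw : intT (fun z => w z ^+ k).
  apply: H2_int; apply: regular_H2; apply: (@regular_eq _ (fun z => ('X^k).[w z])).
    by move=> z _; rewrite hornerXn.
  exact: regular_horner_comp.
have ip : intT (fun z => poisson a z * z ^+ k).
  have i1 : intT (poisson a).
    have [ir ii] := H2_int (regular_H2 regular_cauchy).
    have ic : intT (fun z => ((1 - a^* * z)^-1)^*).
      by split; [under eq_fun do rewrite Re_conjC | under eq_fun do rewrite Im_conjC EFinN; exact: integrableN].
    by apply: intTD; [exact: intTD | exact: intT_cst].
  exact: (intT_mul_exprz k i1).
by rewrite integralTD//; [rewrite integralTZ// integralT_moment mulN1r subrr | exact: intTZ].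
Qed.

Let circle_tau t : circle (tau t) = w (circle t).
Proof. exact: circle_angle. Qed.

Let poissonE t : poisson a (circle t) = ((- g t)%:C)%C.
Proof. by apply: complex_ext; rewrite ?poisson_real//= opprK. Qed.

Let ann (u : R -> R) : measurable_fun setT u -> (forall t, `|u t| <= 1) ->
  \int[mu]_t pairing 1 tau g u t = 0 -> annihilated 1 tau g u.
Proof.
move=> mu_ u1 h; split=> //; first by exists 1.
apply: integral_Rintegral0 h.
by apply: integrable_pairing => //; [exact: integrable_poisson | exists 1].
Qed.

Let ann_cos (k : nat) : annihilated 1 tau g (fun t => cos (k%:R * t)).
Proof.
apply: ann.
- apply: continuous_measurable_fun.
  by apply: (@continuous_scaled _ k%:R cos); exact: continuous_cos.
- by move=> t; rewrite ler_norml cos_geN1 cos_le1.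
have /(congr1 (@complex.Re R)) := moment k; rewrite /integralT [RHS]/= => <-.
apply: eq_Rintegral => t _.
rewrite poissonE -circle_tau !circleX Re_add !Re_mul /pairing /=; ring.
Qed.

Let ann_sin (k : nat) : annihilated 1 tau g (fun t => sin (k%:R * t)).
Proof.
apply: ann.
- apply: continuous_measurable_fun.
  by apply: (@continuous_scaled _ k%:R sin); exact: continuous_sin.
- by move=> t; rewrite ler_norml sin_geN1 sin_le1.
have /(congr1 (@complex.Im R)) := moment k; rewrite /integralT [RHS]/= => <-.
apply: eq_Rintegral => t _.
rewrite poissonE -circle_tau !circleX Im_add !Im_mul !Re_mul /pairing /=; ring.
Qed.

Let annihilated_arc (E : set R) : measurable E ->
  annihilated 1 tau g (\1_(E `&` `]0, 2 * pi[)).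
Proof. by apply: annihilated_borel => //; exact: integrable_poisson. Qed.

(** Maps with absolutely continuous image measure are nonsingular: a null set pulls
    back to a null set, so composition with w is well defined on a.e. classes. *)
Lemma aeT_comp (P : C -> Prop) : aeT P -> aeT (fun z => P (w z)).
Proof.
move=> [N [mN N0 PN]].
pose I : set R := `]0, 2 * pi[%classic.
(* Within [0, 2 pi], u vanishes outside N and the two endpoints, which represent the same
   point of the circle and are not separated by arcs of ]0, 2 pi[. *)
pose u (t : R) : R := \1_(N `&` I) t + (1 - \1_I t).
have mI : measurable I by exact: measurable_itv.
have u0 t : 0 <= u t.
  by rewrite /u !indicE; case: (_ \in _); case: (_ \in _); rewrite ?subrr ?subr0 ?addr0.
have Au : annihilated 1 tau g u.
  have A1 : annihilated 1 tau g (fun=> 1).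
    by have := ann_cos 0; under eq_fun do rewrite mul0r cos0.
  have := annihilated_lin mtau integrable_poisson 1 (annihilated_arc mN)
    (annihilated_lin mtau integrable_poisson (-1) (annihilated_arc measurableT) A1).
  by congr annihilated; apply/funext => t; rewrite setTI /u /I mul1r mulN1r [- _ + _]addrC.
have [mu_ [M uM] i0] := Au.
have muT : measurable_fun setT (fun t : R => u (tau t)) by exact: measurableT_comp.
have uN : \forall t \ae mu, u t = 0.
  have NN : \forall t \ae mu, ~ N t.
    by exists N; split=> // t /= /contrapT.
  apply: (@filterS2 _ _ (ae_filter_ringOfSetsType mu)) NN (@ae_itvoo R) => t /= Nt It.
  by rewrite /u !indicE in_setI (negbTE (_ : t \notin N)) ?notin_setE// It subrr addr0.
have h : ae_eq mu setT (fun t : R => (u (tau t))%:E) (cst 0%E).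
  apply/ae_eq_integral_abs => //; first exact/measurable_EFinP.
  rewrite -[RHS]i0; apply: ae_eq_integral => //.
  - by apply: measurableT_comp => //; exact/measurable_EFinP.
  - apply/measurable_EFinP; apply: measurable_pairing => //; exact: integrable_poisson.
  - apply: (@filterS _ _ (ae_filter_ringOfSetsType mu)) uN => t ut _ /=.
    by rewrite /pairing ut mul0r addr0 mul1r ger0_norm.
apply: (@filterS _ _ (ae_filter_ringOfSetsType mu)) h => t /= /(_ Logic.I) [].
rewrite /u !indicE in_setI -circle_tau.
case: (boolP (tau t \in I)) => tI; rewrite ?andbT ?andbF.
  case: (boolP (tau t \in N)) => tN.
    by rewrite subrr addr0 => /eqP; rewrite oner_eq0.
  move=> _; apply: contrapT => nP; move/negP: tN; apply; rewrite inE.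
  exact: PN.
by rewrite subr0 add0r => /eqP; rewrite oner_eq0.
Qed.
Lemma measT_comp (f : C -> C) : measT f -> measT (fun z => f (w z)).
Proof.
move=> [fr fi]; split.
  rewrite (_ : (fun t => _) = (fun t => complex.Re (f (circle (tau t))))); last first.
    by apply/funext => t; rewrite circle_tau.
  exact: (measurableT_comp fr mtau).
rewrite (_ : (fun t => _) = (fun t => complex.Im (f (circle (tau t))))); last first.
  by apply/funext => t; rewrite circle_tau.
exact: (measurableT_comp fi mtau).
Qed.
End Nonsingular.

(** * Rational functions on the circle *)

Section RationalOnCircle.
Context {R : realType}.
Local Notation C := R[i].
Local Notation mu := (@arc_measure R).
Implicit Types f g : C -> C.

Lemma angle_circle (t : R) : 0 < t < 2 * pi -> angle (circle t) = t.
Proof.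
move=> /andP[t0 t2]; rewrite /angle /=.
case: (lerP t pi) => tpi.
  rewrite sin_ge0_pi ?(ltW t0)//= cosK// in_itv/= tpi ltW//.
have -> : cos t = cos (2 * pi - t).
  by rewrite cosB (_ : 2 * pi = pi *+ 2) ?mulr_natl// cos2pi sin2pi mul1r mul0r addr0.
rewrite cosK; last by rewrite in_itv/=; lra.
have -> : (0 <= sin t) = false.
  apply/negbTE; rewrite -ltNge -oppr_gt0.
  have -> : - sin t = sin (2 * pi - t).
    by rewrite sinB (_ : 2 * pi = pi *+ 2) ?mulr_natl// cos2pi sin2pi mul0r sub0r mul1r.
  by apply: sin_gt0_pi; lra.
by ring.
Qed.

Lemma aeT_neq (c : C) : aeT (fun z => z != c).
Proof.
have ne : \forall t \ae mu, t \in ~` [set angle c].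
  exists [set angle c]; split => //.
    rewrite /arc_measure /= /mrestr; apply/eqP.
    rewrite -measure_le0 (le_trans (le_measure _ _ _ (@subIsetl _ _ _)))//.
    - by rewrite inE; apply: measurableI => //; exact: measurable_itv.
    - by rewrite inE.
    have l1 : (lebesgue_measure [set angle c] <= 0)%E by rewrite lebesgue_measure_set1.
    exact: l1.
  by move=> t /= /negP; rewrite notin_setE => /contrapT.
apply: (@filterS2 _ _ (ae_filter_ringOfSetsType mu)) (@ae_itvoo R) ne => t /=.
rewrite !inE/= in_itv/= => It nt; apply/eqP => e; apply: nt.
by rewrite -(angle_circle It) e.
Qed.

Lemma aeT_horner_neq0 (q : {poly C}) : q != 0 -> aeT (fun z => q.[z] != 0).
Proof.
move=> q0; have [r qE] := closed_field_poly_normal q.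
have : aeT (fun z => z \notin r).
  elim: r {qE} => [|b r IH]; first exact: aeT_all.
  apply: aeT_imp (aeT_and (aeT_neq b) IH) => t [h1 h2].
  by rewrite in_cons negb_or h1 h2.
apply: aeT_imp => t; rewrite qE hornerZ mulf_eq0 lead_coef_eq0 (negbTE q0) /=.
by rewrite -/(root _ _) root_prod_XsubC.
Qed.

Lemma aeT_exists (P : C -> Prop) : aeT P -> exists t : R, P (circle t).
Proof.
move=> hP; have [||t [_ _ h]] := @aeT_dense _ _ 0 1 hP; last by exists t.
- by rewrite lexx mulr_ge0 ?pi_ge0.
- exact: ltr01.
Qed.

(** A denominator nonzero a.e. on the circle, rather than a nonzero polynomial, makes
    the closure properties immediate, conjugation included. *)
Definition rationalT f := exists p q : {poly C},
  aeT (fun z => q.[z] != 0 /\ f z = p.[z] / q.[z]).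

Lemma rationalT_cst (c : C) : rationalT (fun=> c).
Proof.
exists c%:P, 1; apply: aeT_all => t; rewrite !hornerC divr1.
by split=> //; exact: oner_neq0.
Qed.

Lemma rationalTD f g : rationalT f -> rationalT g -> rationalT (fun z => f z + g z).
Proof.
move=> [p [q h]] [p' [q' h']]; exists (p * q' + p' * q), (q * q').
apply: aeT_imp (aeT_and h h') => t [[q0 ->] [q0' ->]].
by rewrite !hornerE mulf_neq0// addf_div.
Qed.

Lemma rationalTM f g : rationalT f -> rationalT g -> rationalT (fun z => f z * g z).
Proof.
move=> [p [q h]] [p' [q' h']]; exists (p * p'), (q * q').
apply: aeT_imp (aeT_and h h') => t [[q0 ->] [q0' ->]].
by rewrite !hornerM mulf_neq0//; split=> //; rewrite invfM; ring.
Qed.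

Lemma rationalT_sum (I : Type) (r : seq I) (F : I -> C -> C) :
  (forall i, rationalT (F i)) -> rationalT (fun z => \sum_(i <- r) F i z).
Proof.
move=> rF; elim: r => [|i r IH].
  by under eq_fun do rewrite big_nil; exact: rationalT_cst.
by under eq_fun do rewrite big_cons; exact: rationalTD.
Qed.

(** On the circle the conjugate of z is 1 / z. *)
Lemma conj_horner_circle (p : {poly C}) : exists (p' : {poly C}) (n : nat),
  forall t : R, (p.[circle t])^* = p'.[circle t] / circle t ^+ n.
Proof.
elim/poly_ind: p => [|p c [p' [n pE]]].
  by exists 0, 0 => t; rewrite !horner0 rmorph0 mul0r.
exists (p' + c^* *: 'X^(n.+1)), n.+1 => t.
rewrite !hornerE rmorphD rmorphM /= pE conj_circle exprS.
have z0 := @circle_neq0 R t.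
by field; rewrite z0 expf_neq0.
Qed.

Lemma rationalT_conj f : rationalT f -> rationalT (fun z => (f z)^*).
Proof.
move=> [p [q h]].
have [p' [n pE]] := conj_horner_circle p.
have [q' [m qE]] := conj_horner_circle q.
exists (p' * 'X^m), (q' * 'X^n).
apply: aeT_imp h => t [q0 ->].
have z0 := @circle_neq0 R t.
have q0' : q'.[circle t] != 0.
  apply: contra_neq q0 => e; have := qE t.
  by rewrite e mul0r => /eqP; rewrite conjC_eq0 => /eqP.
rewrite !hornerE; split; first by rewrite mulf_neq0// expf_neq0.
rewrite rmorphM fmorphV /= pE qE; field.
by rewrite q0' !expf_neq0.
Qed.

Lemma rationalT_ae f g : aeT (fun z => f z = g z) -> rationalT g -> rationalT f.
Proof.
move=> fg [p [q h]]; exists p, q.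
by apply: aeT_imp (aeT_and fg h) => t [->].
Qed.

Lemma regular_rationalT f : regular f -> rationalT f.
Proof.
move=> [p [q [q0 fE]]]; exists p, q; apply: aeT_all => t.
by split; [apply: q0 | apply: fE]; rewrite norm_circle.
Qed.

Lemma circle_near (t0 : R) (e : R) : 0 < e -> exists2 d : R, 0 < d &
  forall t, `|t - t0| < d -> `|circle t - circle t0| <= (e%:C)%C.
Proof.
move=> e0.
have /cvgrPdist_lt/(_ (e / 2)) := @continuous_cos R t0.
have /cvgrPdist_lt/(_ (e / 2)) := @continuous_sin R t0.
rewrite divr_gt0// => /(_ isT) /nbhs_ballP[d1 /= d10 h1] /(_ isT) /nbhs_ballP[d2 /= d20 h2].
exists (Num.min d1 d2) => [|t]; first by rewrite lt_min d10 d20.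
rewrite lt_min => /andP[t1 t2].
rewrite (le_trans (norm_le_ReIm _))// lecR /=.
have {}h1 := h1 t; have {}h2 := h2 t.
rewrite [e]splitr lerD// distrC ltW//; [apply: h2|apply: h1]; by rewrite /ball/= distrC.
Qed.

(** A function in H2 that is bounded on the circle has no pole in the closed disc:
    in the interior by the recursion (z - a) h = c imposes on the Fourier coefficients
    of h, on the circle by boundedness. *)
Lemma no_pole (h : C -> C) (a c : C) (M : R) : `|a| <= 1 -> HpT 2%:E h ->
  aeT (fun z => `|h z| <= (M%:C)%C) -> aeT (fun z => (z - a) * h z = c) -> c = 0.
Proof.
move=> a1 hh hM hc; have ih := H2_int hh.
have [a_eq1|a_neq1] := eqVneq `|a| 1.
  have [t0 ta t0b] : exists2 t0 : R, circle t0 = a & 0 <= t0 <= 2 * pi.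
    by exists (angle a); [exact: circle_angle | exact: angle_bound].
  apply/eqP; apply: contrapT => /negP c0.
  pose d := complex.Re `|c|.
  have dE : `|c| = (d%:C)%C by rewrite RRe_real// normr_real.
  have d0 : 0 < d by rewrite -ltcR -dE normr_gt0.
  have M0 : 0 <= M.
    by have [t /(le_trans (normr_ge0 _))] := aeT_exists hM; rewrite -lecR.
  have e0 : 0 < d / (2 * (M + 1)) by rewrite divr_gt0//; lra.
  have [r r0 hr] := circle_near t0 e0.
  have [t [_ tr [hMt hct]]] := aeT_dense (aeT_and hM hc) t0b r0.
  have : `|c| <= ((d / (2 * (M + 1)))%:C * M%:C)%C.
    by rewrite -hct normrM ler_pM// -ta; exact: hr.
  rewrite dE -rmorphM lecR.
  have M1 : M + 1 != 0 by rewrite gt_eqF// ltr_wpDl.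
  have -> : d / (2 * (M + 1)) * M = d / 2 - d / (2 * (M + 1)) by field.
  by lra.
have rec (k : int) : fourier h (k - 1) - a * fourier h k = if k == 0 then c else 0.
  rewrite -fourier_shift -mulNr -fourierZ// -fourierD; [|exact: H2_int (H2_shift hh)|exact: intTZ].
  rewrite -fourier_cst; apply: fourier_ae.
  - by apply: intT_measT; apply: intTD; [exact: H2_int (H2_shift hh)|exact: intTZ].
  - exact: measT_cst.
  - by apply: aeT_imp hc => t <-; rewrite mulNr -mulrBl.
have c_eq : c = - (a * fourier h 0).
  have := rec 0; rewrite eqxx sub0r => <-.
  by case: hh => _ ->//; rewrite sub0r.
have [a0|a0] := eqVneq a 0; first by rewrite c_eq a0 mul0r oppr0.
have [N hN] := fourier_bound ih.
rewrite c_eq (@geometric_bounded_eq0 _ a^-1 (fourier h 0) N) ?mulr0 ?oppr0//.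
  by rewrite normfV invf_gt1 ?normr_gt0// lt_neqAle a_neq1.
move=> k; suff -> : a^-1 ^+ k * fourier h 0 = fourier h k%:Z by [].
elim: k => [|k IH]; first by rewrite mul1r.
have := rec k.+1%:Z; rewrite (_ : k.+1%:Z - 1 = k%:Z); last by rewrite -addn1 PoszD addrK.
move=> /= /eqP; rewrite subr_eq0 => /eqP e.
by rewrite exprS -mulrA IH e mulrA mulVf ?mul1r.
Qed.

(** The poles in the closed disc are removed one at a time: if q1 (z - a) is the
    denominator and u the quotient of p by z - a, then h = q1 f - u satisfies
    (z - a) h = p(a), hence p(a) = 0 and z - a cancels. *)
Lemma bounded_H2_rational_regular f (M : R) : HpT 2%:E f ->
  aeT (fun z => `|f z| <= (M%:C)%C) -> rationalT f ->
  exists2 g, regular g & aeT (fun z => f z = g z).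
Proof.
move=> hf fM [p [q h]].
have q0 : q != 0.
  have [t [qt _]] := aeT_exists h; apply: contra_neq qt => ->; exact: horner0.
have {}h : aeT (fun z => f z = p.[z] / q.[z]) by apply: aeT_imp h => t [].
have [n] := ubnP (size q); elim: n => // n IH in p q q0 h *; rewrite ltnS => sq.
have [[a qa a1]|nroot] := pselect (exists2 a, root q a & `|a| <= 1); last first.
  exists (fun z => p.[z] / q.[z]) => //; exists p, q; split=> // z z1.
  by apply/negP => qz; apply: nroot; exists z.
have /factor_theorem[q1 qE] := qa.
have q10 : q1 != 0 by apply: contra_neq q0 => e; rewrite qE e mul0r.
have /factor_theorem[u uE] : root (p - (p.[a])%:P) a.
  by rewrite /root hornerD hornerN hornerC subrr.
have pE z : p.[z] = u.[z] * (z - a) + p.[a].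
  by have /(congr1 (horner^~ z)) := uE; rewrite !hornerE => <-; rewrite subrK.
have zE z : (q1 * ('X - a%:P)).[z] = q1.[z] * (z - a) by rewrite hornerM hornerXsubC.
have rq (v : {poly C}) := @regular_poly R v.
have pa : p.[a] = 0.
  have [N1 hN1] := regular_bounded (rq q1).
  have [N2 hN2] := regular_bounded (rq (- u)).
  apply: (@no_pole (fun z => q1.[z] * f z + (- u).[z]) a _ (N1 * M + N2)) => //.
  - by apply: H2D; [exact: H2_horner | exact: regular_H2].
  - apply: aeT_imp fM => t ft.
    by rewrite (le_trans (ler_normD _ _))// rmorphD rmorphM lerD// normrM ler_pM.
  - apply: aeT_imp (aeT_and h (aeT_and (aeT_neq a) (aeT_horner_neq0 q10))) => t [-> [ta qt]].
    rewrite qE zE pE hornerN.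
    have ta' : circle t - a != 0 by rewrite subr_eq0.
    by field; rewrite qt ta'.
apply: (IH u q1) => //.
  apply: aeT_imp (aeT_and h (aeT_and (aeT_neq a) (aeT_horner_neq0 q10))) => t [-> [ta qt]].
  rewrite qE zE pE pa.
  have ta' : circle t - a != 0 by rewrite subr_eq0.
  by field; rewrite qt ta'.
by move: sq; rewrite qE size_Mmonic ?monicXsubC// size_XsubC addn2.
Qed.

End RationalOnCircle.

(** * Bezout identities and left coprimeness *)

Local Open Scope sesquilinear_scope.

Section RegularMatrices.
Context {R : realType}.
Local Notation C := R[i].

Definition regular_mx m n (F : C -> 'M[C]_(m, n)) := forall i j, regular (fun z => F z i j).

Lemma regular_mx_cst m n (M : 'M[C]_(m, n)) : regular_mx (fun=> M).
Proof. by move=> i j; exact: regular_cst. Qed.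

Lemma regular_mxD m n (F G : C -> 'M[C]_(m, n)) : regular_mx F -> regular_mx G ->
  regular_mx (fun z => F z + G z).
Proof. by move=> rF rG i j; under eq_fun do rewrite mxE; exact: regularD. Qed.

Lemma regular_mxZ m n (f : C -> C) (F : C -> 'M[C]_(m, n)) : regular f ->
  regular_mx F -> regular_mx (fun z => f z *: F z).
Proof. by move=> rf rF i j; under eq_fun do rewrite mxE; exact: regularM. Qed.

Lemma regular_mxM m n p (F : C -> 'M[C]_(m, n)) (G : C -> 'M[C]_(n, p)) :
  regular_mx F -> regular_mx G -> regular_mx (fun z => F z *m G z).
Proof.
move=> rF rG i j; under eq_fun do rewrite mxE.
by apply: regular_sum => k; exact: regularM.
Qed.

Lemma regular_mx_comp m n (F : C -> 'M[C]_(m, n)) (g : C -> C) : regular_mx F ->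
  regular g -> (forall z, `|z| <= 1 -> `|g z| <= 1) -> regular_mx (fun z => F (g z)).
Proof. by move=> rF rg g1 i j; exact: (regular_comp (rF i j)). Qed.

Lemma regular_det n (F : C -> 'M[C]_n) : regular_mx F -> regular (fun z => \det (F z)).
Proof.
move=> rF; apply: regular_sum => s; apply: regularM; first exact: regular_cst.
by apply: regular_prod => i _; exact: rF.
Qed.

Lemma regular_adj n (F : C -> 'M[C]_n) : regular_mx F -> regular_mx (fun z => \adj (F z)).
Proof.
move=> rF i j; under eq_fun do rewrite mxE /cofactor.
apply: regularM; first exact: regular_cst.
by apply: regular_det => a b; under eq_fun do rewrite !mxE; exact: rF.
Qed.

(** The corona theorem for rational matrices: the polynomials d such that
    F X + G Y = d for some regular X, Y form an ideal; near each point the adjugate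
    of a right combination invertible there gives such a d without zero at the point,
    so a generator of the ideal has no zero in the closed disc. *)
Lemma regular_bezout n k l (F : C -> 'M[C]_(n, k)) (G : C -> 'M[C]_(n, l)) :
  regular_mx F -> regular_mx G ->
  (forall a, `|a| <= 1 -> exists X0 Y0, F a *m X0 + G a *m Y0 = 1%:M) ->
  exists X Y, [/\ regular_mx X, regular_mx Y &
    forall z, `|z| <= 1 -> F z *m X z + G z *m Y z = 1%:M].
Proof.
move=> rF rG pointwise.
pose J (d : {poly C}) := exists X Y, [/\ regular_mx X, regular_mx Y &
    forall z, `|z| <= 1 -> F z *m X z + G z *m Y z = (d.[z])%:M].
have Jlin (u d e : {poly C}) : J d -> J e -> J (d - u * e).
  move=> [X [Y [rX rY E]]] [X' [Y' [rX' rY' E']]].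
  exists (fun z => X z + (- u).[z] *: X' z), (fun z => Y z + (- u).[z] *: Y' z); split.
  - by apply: regular_mxD => //; apply: regular_mxZ => //; exact: regular_poly.
  - by apply: regular_mxD => //; apply: regular_mxZ => //; exact: regular_poly.
  move=> z z1; rewrite !mulmxDr -!scalemxAr addrACA -scalerDr E// E'//.
  by rewrite scale_scalar_mx -raddfD /= !hornerE mulNr.
have Jloc a : `|a| <= 1 -> exists2 d, J d & d.[a] != 0.
  move=> a1; have [X0 [Y0 E0]] := pointwise a a1.
  pose N z := F z *m X0 + G z *m Y0.
  have rN : regular_mx N.
    by apply: regular_mxD; apply: regular_mxM => //; exact: regular_mx_cst.
  have [p [q [q0 pE]]] := regular_det rN.
  exists p; last first.
    have := pE a a1; rewrite /N E0 det1 => e; apply/eqP => pa.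
    by move/eqP: e; rewrite pa mul0r oner_eq0.
  exists (fun z => X0 *m (q.[z] *: \adj (N z))), (fun z => Y0 *m (q.[z] *: \adj (N z))).
  have rA : regular_mx (fun z => q.[z] *: \adj (N z)).
    by apply: regular_mxZ; [exact: regular_poly | exact: regular_adj].
  split.
  - by apply: regular_mxM => //; exact: regular_mx_cst.
  - by apply: regular_mxM => //; exact: regular_mx_cst.
  move=> z z1; rewrite !mulmxA -mulmxDl -/(N z) -scalemxAr mul_mx_adj pE//.
  by rewrite scale_scalar_mx mulrCA mulfV ?mulr1 ?q0.
have [g [Jg g0 gmin]] : exists g, [/\ J g, g != 0 &
    forall d, J d -> d != 0 -> (size g <= size d)%N].
  have n0 : `|0 : C| <= 1 by rewrite normr0.
  have [d Jd d0] := Jloc 0 n0.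
  have {}d0 : d != 0 by apply: contra_neq d0 => ->; rewrite horner0.
  have [m] := ubnP (size d); elim: m => // m IH in d Jd d0 *; rewrite ltnS => dm.
  have [[e [Je e0 es]]|nex] := pselect (exists e, [/\ J e, e != 0 & (size e < size d)%N]).
    by apply: (IH e) => //; exact: leq_trans es dm.
  exists d; split=> // e Je e0; rewrite leqNgt; apply/negP => es.
  by apply: nex; exists e.
have gdvd d : J d -> g %| d.
  move=> Jd; apply: contrapT => /negP; rewrite /dvdp => r0.
  have Jr : J (d %% g) by rewrite -[_ %% _](addKr (d %/ g * g)) -divp_eq addrC; exact: Jlin.
  by have := gmin _ Jr r0; rewrite leqNgt ltn_modp g0.
have gz z : `|z| <= 1 -> g.[z] != 0.
  move=> z1; have [d Jd dz] := Jloc z z1.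
  by apply: contra_neq dz => gz0; have /dvdpP[u ->] := gdvd d Jd; rewrite hornerM gz0 mulr0.
have [X [Y [rX rY E]]] := Jg.
have rg : regular (fun z => g.[z]^-1) by apply: regularV => //; exact: regular_poly.
exists (fun z => g.[z]^-1 *: X z), (fun z => g.[z]^-1 *: Y z).
split; [exact: regular_mxZ|exact: regular_mxZ|move=> z z1].
by rewrite -!scalemxAr -scalerDr E// scale_scalar_mx mulVf ?gz.
Qed.

End RegularMatrices.

Section Coprimeness.
Context {R : realType}.
Local Notation C := R[i].

(** If F X + G Y = 1 and Delta divides F and G then Delta K = 1 with K in H2; as
    Delta is isometric, K is its adjoint, so the entries of Delta and their conjugates
    lie in H2 and are constant. *)
Lemma left_coprime_bezout n k l (F : C -> 'M[C]_(n, k)) (G : C -> 'M[C]_(n, l))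
    (X : C -> 'M[C]_(k, n)) (Y : C -> 'M[C]_(l, n)) :
  regular_mx X -> regular_mx Y -> aeT (fun z => F z *m X z + G z *m Y z = 1%:M) ->
  left_coprime F G.
Proof.
move=> rX rY bez m Delta [[Doo Diso] [G1 [hG1 FE]]] [_ [G2 [hG2 GE]]].
pose K z := G1 z *m X z + G2 z *m Y z.
have hK i j : HpT 2%:E (fun z => K z i j).
  under eq_fun do rewrite !mxE.
  have hs p (H : C -> 'M[C]_(m, p)) (Z : C -> 'M[C]_(p, n)) : H2 H -> regular_mx Z ->
      HpT 2%:E (fun z => \sum_q H z i q * Z z q j).
    move=> hH rZ; elim: (index_enum _) => [|q r IH].
      by under eq_fun do rewrite big_nil; exact: H2_cst.
    under eq_fun do rewrite big_cons mulrC.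
    by apply: H2D => //; exact: regularM_H2.
  by apply: H2D; exact: hs.
have DK : aeT (fun z => Delta z *m K z = 1%:M).
  apply: aeT_imp (aeT_and bez (aeT_and FE GE)) => t [<- [-> ->]].
  by rewrite /K mulmxDr !mulmxA.
have KE : aeT (fun z => K z = (Delta z)^t*).
  apply: aeT_imp (aeT_and DK Diso) => t [h1 h2].
  by rewrite -[LHS]mul1mx -h2 -mulmxA h1 mulmx1.
pose U : 'M[C]_(n, m) := \matrix_(i, j) fourier (fun z => Delta z i j) 0.
have DU : aeT (fun z => Delta z = U).
  have : aeT (fun z => forall i j, Delta z i j = U i j).
    apply: aeT_forall => i; apply: aeT_forall => j.
    rewrite /U; under eq_fun do rewrite mxE.
    have [lD fD] := Doo i j.
    have l2 : LpT 2%:E (fun z => Delta z i j).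
      by apply: LpT_subset lD; rewrite ?leey ?lee1n.
    apply: H2_conj_constant; first by split.
    have [[kr ki] fK] := hK j i.
    have l2c : LpT 2%:E (fun z => (Delta z i j)^*).
      case: l2 => lr li; split; first by under eq_fun do rewrite Re_conjC.
      by under eq_fun do rewrite Im_conjC; exact: Lfun_oppr_closed.
    split=> // q q0; rewrite -(fK q q0); apply: fourier_ae.
    - exact: LpT_measT l2c.
    - by apply: (@LpT_measT _ 2%:E); split.
    - by apply: aeT_imp KE => t ->; rewrite !mxE.
  by apply: aeT_imp => t h; apply/matrixP => i j.
exists U; split=> //.
  by have [t [h <-]] := aeT_exists (aeT_and Diso DU).
have [t [h1 [h2 <-]]] := aeT_exists (aeT_and DK (aeT_and KE DU)).
by rewrite -h2.
Qed.

End Coprimeness.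

Section BlaschkeDivisor.
Context {R : realType}.
Local Notation C := R[i].

Lemma regular_blaschke (a : C) : `|a| < 1 -> regular (blaschke_factor a).
Proof.
move=> a1; apply: regularM; last exact: regular_cauchy.
by apply: regularD; [exact: regular_id | exact: regular_cst].
Qed.

Lemma norm_blaschke_circle (a z : C) : `|a| < 1 -> `|z| = 1 -> `|blaschke_factor a z| = 1.
Proof.
move=> a1 z1; have d0 : 1 - a^* * z != 0 by rewrite cauchy_neq0// z1.
have zz : z^* * z = 1 by rewrite mulrC -normCK z1 expr1n.
rewrite /blaschke_factor normrM normfV.
have -> : `|1 - a^* * z| = `|z - a|.
  have -> : 1 - a^* * z = (z - a)^* * z by rewrite rmorphB /= mulrBl zz.
  by rewrite normrM norm_conjC z1 mulr1.
rewrite divff// normr_eq0; apply: contra_neq d0 => e.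
have -> : 1 - a^* * z = (z - a)^* * z by rewrite rmorphB /= mulrBl zz.
by rewrite e rmorph0 mul0r.
Qed.

Lemma norm_blaschke_le1 (a z : C) : `|a| < 1 -> `|z| <= 1 -> `|blaschke_factor a z| <= 1.
Proof.
move=> a1 z1; have d0 := cauchy_neq0 a1 z1.
rewrite /blaschke_factor normrM normfV ler_pdivrMr ?normr_gt0// mul1r.
rewrite -(@ler_pXn2r _ 2)// ?nnegrE// !normCK !rmorphB rmorphM rmorph1 /= conjCK.
have h : 0 <= (1 - `|a| ^+ 2) * (1 - `|z| ^+ 2).
  by rewrite mulr_ge0 ?subr_ge0 ?exprn_ile1 ?(ltW a1).
rewrite -subr_ge0; apply: le_trans h _; rewrite !normCK le_eqVlt; apply/orP; left.
by apply/eqP; ring.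
Qed.

Lemma blaschke_inj (a z z' : C) : `|a| < 1 -> `|z| <= 1 -> `|z'| <= 1 ->
  blaschke_factor a z = blaschke_factor a z' -> z = z'.
Proof.
move=> a1 z1 z1' /eqP; rewrite /blaschke_factor eqr_div ?cauchy_neq0// => /eqP e.
have : (z - z') * (1 - a^* * a) = 0.
  move/eqP: e; rewrite -subr_eq0 => /eqP <-; ring.
move/eqP; rewrite mulf_eq0 subr_eq0 => /orP[/eqP//|].
rewrite subr_eq0 mulrC -normCK => /eqP e1.
by have := expr_lt1 (ltn0Sn 1) (normr_ge0 a); rewrite a1 -e1 ltxx.
Qed.

Definition potapov n (P : 'M[C]_n) (a z : C) := blaschke_factor a z *: P + (1%:M - P).

Lemma regular_potapov n (P : 'M[C]_n) a : `|a| < 1 -> regular_mx (potapov P a).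
Proof.
move=> a1; apply: regular_mxD; last exact: regular_mx_cst.
by apply: regular_mxZ; [exact: regular_blaschke | exact: regular_mx_cst].
Qed.

Lemma potapov_mul n (P : 'M[C]_n) (b b' : C) : P *m P = P ->
  (b *: P + (1%:M - P)) *m (b' *: P + (1%:M - P)) = (b * b') *: P + (1%:M - P).
Proof.
move=> PP; have PQ : P *m (1%:M - P) = 0 by rewrite mulmxBr mulmx1 PP subrr.
have QP : (1%:M - P) *m P = 0 by rewrite mulmxBl mul1mx PP subrr.
have QQ : (1%:M - P) *m (1%:M - P) = 1%:M - P by rewrite mulmxBl mul1mx PQ subr0.
move: (1%:M - P) PQ QP QQ => Q PQ QP QQ.
by rewrite mulmxDl !mulmxDr -!scalemxAl -!scalemxAr PP PQ QP QQ scalerA !scaler0 addr0 add0r.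
Qed.

Lemma potapov_adj n (P : 'M[C]_n) (b : C) : P^t* = P ->
  (b *: P + (1%:M - P))^t* = b^* *: P + (1%:M - P).
Proof.
move=> Ps; apply/matrixP => i j; rewrite !mxE rmorphD rmorphM rmorphB /=.
have -> : (P j i)^* = P i j by rewrite -[in RHS]Ps !mxE.
by rewrite rmorph_nat eq_sym.
Qed.

Lemma inner_potapov n (P : 'M[C]_n) a : `|a| < 1 -> orthogonal_projection P ->
  inner (potapov P a).
Proof.
move=> a1 [Ps PP]; split; first by move=> i j; apply: regular_Hoo; exact: regular_potapov.
apply: aeT_all => t; rewrite /potapov potapov_adj// potapov_mul//.
by rewrite mulrC -normCK norm_blaschke_circle ?norm_circle// expr1n scale1r addrC subrK.
Qed.

(** P F vanishes at a, so P F = (z - a) H, and the inverse (1 / b) P + (1 - P) of the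
    factor maps F to the pole-free (1 - conj a z) P H + (1 - P) F. *)
Lemma potapov_divides n k (P : 'M[C]_n) a (F : C -> 'M[C]_(n, k)) : `|a| < 1 ->
  orthogonal_projection P -> regular_mx F -> P *m F a = 0 ->
  exists2 G, regular_mx G & forall z, `|z| <= 1 -> F z = potapov P a z *m G z.
Proof.
move=> a1 [_ PP] rF PF.
have rPF : regular_mx (fun z => P *m F z) by apply: regular_mxM => //; exact: regular_mx_cst.
have : forall ij : 'I_n * 'I_k, exists g, regular g /\
    forall z, `|z| <= 1 -> (P *m F z) ij.1 ij.2 = (z - a) * g z.
  move=> [i j] /=; have PFa : (P *m F a) i j = 0 by rewrite PF mxE.
  by have [g rg gE] := regular_factor (ltW a1) (rPF i j) PFa; exists g.
move=> /choice[h hE].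
pose H z : 'M[C]_(n, k) := \matrix_(i, j) h (i, j) z.
have rH : regular_mx H.
  by move=> i j; under eq_fun do rewrite mxE; have [] := hE (i, j).
have HE z : `|z| <= 1 -> P *m F z = (z - a) *: H z.
  by move=> z1; apply/matrixP => i j; rewrite [LHS](proj2 (hE (i, j))) ?mxE.
exists (fun z => (1 - a^* * z) *: (P *m H z) + (1%:M - P) *m F z).
  apply: regular_mxD; last by apply: regular_mxM => //; exact: regular_mx_cst.
  apply: regular_mxZ; last by apply: regular_mxM => //; exact: regular_mx_cst.
  apply: (@regular_eq _ (fun z => 1 + - a^* * z)); first by move=> z _; rewrite mulNr.
  apply: regularD; first exact: regular_cst.
  by apply: regularM; [exact: regular_cst | exact: regular_id].
move=> z z1; have d0 := cauchy_neq0 a1 z1.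
have PQ : P *m (1%:M - P) = 0 by rewrite mulmxBr mulmx1 PP subrr.
have QQ : (1%:M - P) *m (1%:M - P) = 1%:M - P by rewrite mulmxBl mul1mx PQ subr0.
have QP : (1%:M - P) *m P = 0 by rewrite mulmxBl mul1mx PP subrr.
have FE : F z = P *m F z + (1%:M - P) *m F z by rewrite -mulmxDl addrC subrK mul1mx.
rewrite {1}FE /potapov; move: (1%:M - P) PQ QQ QP {FE} => Q PQ QQ QP.
rewrite mulmxDl !mulmxDr -!scalemxAl -!scalemxAr !mulmxA PP PQ QP QQ.
rewrite !mul0mx !scaler0 addr0 add0r scalerA /blaschke_factor -mulrA mulVf// mulr1.
by rewrite scalemxAr -HE// mulmxA PP.
Qed.

End BlaschkeDivisor.

(** * Left coprime factorizations and composition *)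

Section Pointwise.
Context {R : realType}.
Local Notation C := R[i].

Lemma row_norm_neq0 n (v : 'rV[C]_n) : v != 0 -> (v *m v^t*) 0 0 != 0.
Proof.
apply: contra_neq => e; apply/rowP => i; rewrite mxE.
have : \sum_j `|v 0 j| ^+ 2 = 0.
  by rewrite -[RHS]e mxE; apply: eq_bigr => j _; rewrite !mxE normCK.
move/eqP; rewrite psumr_eq0; last by move=> j _; rewrite exprn_ge0.
by move=> /allP/(_ i); rewrite mem_index_enum sqrf_eq0 normr_eq0 => /(_ isT)/eqP.
Qed.

Lemma trmxC_mul m n p (M : 'M[C]_(m, n)) (N : 'M[C]_(n, p)) :
  (M *m N)^t* = N^t* *m M^t*.
Proof. by rewrite trmx_mul map_mxM. Qed.

Lemma trmxC_K m n (M : 'M[C]_(m, n)) : (M^t*)^t* = M.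
Proof. by apply/matrixP => i j; rewrite !mxE conjCK. Qed.

(** P = v^* v / (v v^* ) is the projection on the line of v^*. *)
Lemma row_projection n (v : 'rV[C]_n) : v != 0 -> exists P : 'M[C]_n,
  [/\ orthogonal_projection P, v *m P = v &
      forall k (M : 'M[C]_(n, k)), v *m M = 0 -> P *m M = 0].
Proof.
move=> v0; pose s := (v *m v^t*) 0 0; have s0 : s != 0 := row_norm_neq0 v0.
have vv : v *m v^t* = s%:M by rewrite [LHS]mx11_scalar.
have sr : s^* = s.
  have -> : s^* = ((v *m v^t*)^t*) 0 0 by rewrite [RHS]mxE [in RHS]mxE.
  by rewrite trmxC_mul trmxC_K.
exists (s^-1 *: (v^t* *m v)); split; first split.
- transitivity ((s^-1)^* *: (v^t* *m v)^t*).
    by apply/matrixP => i j; rewrite !mxE rmorphM.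
  by rewrite fmorphV /= sr trmxC_mul trmxC_K.
- rewrite -scalemxAl -scalemxAr mulmxA -(mulmxA (v^t*)) vv mul_mx_scalar.
  by rewrite -scalemxAl scalerA mulVf// scale1r.
- by rewrite -scalemxAr mulmxA vv mul_scalar_mx scalerA mulVf// scale1r.
- by move=> k M vM; rewrite -scalemxAl -mulmxA vM mulmx0 scaler0.
Qed.

(** Otherwise some row v annihilates F' a and G' a, and the elementary factor at a of
    the projection on the line of its adjoint is a common divisor; it is not constant,
    since a Blaschke factor separates the points of the circle. *)
Lemma left_coprime_pointwise n k l (F F' : C -> 'M[C]_(n, k)) (G G' : C -> 'M[C]_(n, l)) a :
  regular_mx F' -> regular_mx G' -> aeT (fun z => F z = F' z) ->
  aeT (fun z => G z = G' z) -> left_coprime F G -> `|a| < 1 ->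
  exists X0 Y0, F' a *m X0 + G' a *m Y0 = 1%:M.
Proof.
move=> rF rG FE GE cop a1.
have [/row_freeP[Z ZE]|nfree] := boolP (row_free (row_mx (F' a) (G' a))).
  by exists (usubmx Z), (dsubmx Z); rewrite -mul_row_col vsubmxK.
have [v v0 vB] : exists2 v : 'rV_n, v != 0 & v *m row_mx (F' a) (G' a) = 0.
  move: nfree; rewrite -kermx_eq0 => /rowV0Pn[v /sub_kermxP vB v0].
  by exists v.
move: vB; rewrite mul_mx_row -row_mx0 => /eq_row_mx[vF vG].
have [P [hP vP killP]] := row_projection v0.
have div j (H H' : C -> 'M[C]_(n, j)) : regular_mx H' -> aeT (fun z => H z = H' z) ->
    v *m H' a = 0 -> left_inner_divisor (potapov P a) H.
  move=> rH HE vH; split; first exact: inner_potapov.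
  have [K rK KE] := potapov_divides a1 hP rH (killP _ _ vH).
  exists K; split; first by move=> i q; apply: regular_H2; exact: rK.
  by apply: aeT_imp HE => t ->; rewrite KE// norm_circle.
have [U [_ _ hU]] := cop _ _ (div _ _ _ rF FE vF) (div _ _ _ rG GE vG).
have pi2 := pi_ge2 R.
have [||t1 [t1b t10 h1]] := @aeT_dense _ _ 0 1 hU; rewrite ?ltr01//.
  by apply/andP; split=> //; lra.
have [||t2 [t2b t20 h2]] := @aeT_dense _ _ (2 * pi) 1 hU; rewrite ?ltr01//.
  by apply/andP; split=> //; lra.
have t12 : circle t1 != circle t2 :> C.
  apply/eqP => /(congr1 angle); rewrite !angle_circle// => e.
  by move: t10 t20; rewrite e !ltr_norml; lra.
have : (blaschke_factor a (circle t1) - blaschke_factor a (circle t2)) *: P = 0.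
  rewrite scalerBl; apply/eqP; rewrite subr_eq0; apply/eqP.
  by apply: (addIr (1%:M - P)); rewrite -!/(potapov P a _) h1 h2.
move/eqP; rewrite scaler_eq0 => /orP[|/eqP P0].
  rewrite subr_eq0 => /eqP/blaschke_inj e.
  by move/eqP: t12; case; apply: e => //; rewrite norm_circle.
by move: v0; rewrite -vP P0 mulmx0 eqxx.
Qed.

End Pointwise.

Section BlaschkePotapov.
Context {R : realType}.
Local Notation C := R[i].

Lemma blaschke_potapov_regular n (Theta : C -> 'M[C]_n) : finite_blaschke_potapov Theta ->
  exists T, [/\ regular_mx T, aeT (fun z => Theta z = T z) &
    forall z, `|z| = 1 -> T z \in unitmx].
Proof.
move=> [nu [M [a [P [hnu hP TE]]]]].
exists (fun z => nu *m \prod_(m < M) potapov (P m) (a m) z); split=> //.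
  apply: regular_mxM; first exact: regular_mx_cst.
  elim: (index_enum _) => [|m r IH].
    by under eq_fun do rewrite big_nil; exact: regular_mx_cst.
  under eq_fun do rewrite big_cons.
  by apply: regular_mxM => //; apply: regular_potapov; have [] := hP m.
move=> z z1; rewrite unitmx_mul; apply/andP; split.
  by have /unitarymxP/mulmx1_unit[] := hnu.
elim: (index_enum _) => [|m r IH]; first by rewrite big_nil unitmx1.
rewrite big_cons unitmx_mul IH andbT.
have [am [_ PP]] := hP m.
have b0 : blaschke_factor (a m) z != 0.
  by rewrite -normr_eq0 norm_blaschke_circle ?oner_eq0.
have : potapov (P m) (a m) z *m
    ((blaschke_factor (a m) z)^-1 *: P m + (1%:M - P m)) = 1%:M.
  by rewrite /potapov potapov_mul// mulfV// scale1r addrC subrK.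
by move=> /mulmx1_unit[].
Qed.

Lemma blaschke_product_regular (c : C) (s : seq C) : (forall a, a \in s -> `|a| < 1) ->
  regular (fun z => c * \prod_(a <- s) blaschke_factor a z).
Proof.
move=> hs; apply: regularM; first exact: regular_cst.
by apply: regular_prod => a /hs; exact: regular_blaschke.
Qed.

Lemma norm_blaschke_product_le1 (s : seq C) z : (forall a, a \in s -> `|a| < 1) ->
  `|z| <= 1 -> `|\prod_(a <- s) blaschke_factor a z| <= 1.
Proof.
move=> hs z1; elim: s hs => [|a s IH] hs; first by rewrite big_nil normr1.
rewrite big_cons normrM mulr_ile1//.
  by apply: norm_blaschke_le1 => //; apply: hs; rewrite mem_head.
by apply: IH => b bs; apply: hs; rewrite in_cons bs orbT.
Qed.

Lemma norm_blaschke_product_circle (s : seq C) z : (forall a, a \in s -> `|a| < 1) ->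
  `|z| = 1 -> `|\prod_(a <- s) blaschke_factor a z| = 1.
Proof.
move=> hs z1; elim: s hs => [|a s IH] hs; first by rewrite big_nil normr1.
rewrite big_cons normrM norm_blaschke_circle ?mul1r//; last by apply: hs; rewrite mem_head.
by apply: IH => b bs; apply: hs; rewrite in_cons bs orbT.
Qed.

Lemma HpT_ae_regular (f g : C -> C) : measT f -> aeT (fun z => f z = g z) -> regular g ->
  HpT 2%:E f /\ HpT +oo%E f.
Proof.
move=> mf fg rg; have [M hM] := regular_bounded rg.
have fM : aeT (fun z => `|f z| <= (M%:C)%C) by apply: aeT_imp fg => t ->.
have f0 k : k < 0 -> fourier f k = 0.
  move=> k0; rewrite (fourier_ae k mf (regular_measT rg) fg).
  by have [_ ->] := regular_H2 rg.
split; split=> //; first exact: LpT_bounded fM.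
by apply/LpT_ooP; split=> //; exists M.
Qed.

Lemma bounded_mul_ae (f g : C -> C) : (exists M : R, aeT (fun z => `|f z| <= (M%:C)%C)) ->
  (exists M : R, aeT (fun z => `|g z| <= (M%:C)%C)) ->
  exists M : R, aeT (fun z => `|f z * g z| <= (M%:C)%C).
Proof.
move=> [M hM] [N hN]; exists (M * N); apply: aeT_imp (aeT_and hM hN) => t [h1 h2].
by rewrite normrM rmorphM ler_pM.
Qed.

Lemma bounded_sum_ae (I : Type) (r : seq I) (F : I -> C -> C) :
  (forall i, exists M : R, aeT (fun z => `|F i z| <= (M%:C)%C)) ->
  exists M : R, aeT (fun z => `|\sum_(i <- r) F i z| <= (M%:C)%C).
Proof.
move=> hF; elim: r => [|i r [N hN]].
  by exists 0; apply: aeT_all => t; rewrite big_nil normr0.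
have [M hM] := hF i; exists (M + N); apply: aeT_imp (aeT_and hM hN) => t [h1 h2].
by rewrite big_cons rmorphD (le_trans (ler_normD _ _))// lerD.
Qed.

(** On the circle A = Theta Phi^*, so A is rational and bounded; being in H2 it
    has no poles in the closed disc. *)
Lemma cofactor_regular n (Phi A Theta T : C -> 'M[C]_n) : Hinfty Phi -> rational_mx Phi ->
  inner Theta -> H2 A -> aeT (fun z => Phi z = (A z)^t* *m Theta z) ->
  regular_mx T -> aeT (fun z => Theta z = T z) ->
  exists2 A', regular_mx A' & aeT (fun z => A z = A' z).
Proof.
move=> hPhi rPhi [_ iso] hA fact rT TE.
have AE : aeT (fun z => A z = T z *m (Phi z)^t*).
  apply: aeT_imp (aeT_and iso (aeT_and fact TE)) => t [h1 [-> <-]].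
  by rewrite trmxC_mul trmxC_K mulmxA (mulmx1C h1) mul1mx.
have entry (ij : 'I_n * 'I_n) : exists g, regular g /\ aeT (fun z => A z ij.1 ij.2 = g z).
  case: ij => i j /=.
  pose f z := \sum_k T z i k * (Phi z j k)^*.
  have fE : aeT (fun z => A z i j = f z).
    by apply: aeT_imp AE => t ->; rewrite mxE; apply: eq_bigr => k _; rewrite !mxE.
  have [M fM] : exists M : R, aeT (fun z => `|f z| <= (M%:C)%C).
    apply: bounded_sum_ae => k; apply: bounded_mul_ae.
      by have [M hM] := regular_bounded (rT i k); exists M; exact: aeT_all.
    have [/LpT_ooP[_ [M hM]] _] := hPhi j k; exists M.
    by apply: aeT_imp hM => t; rewrite norm_conjC.
  have rf : rationalT f.
    apply: rationalT_sum => k; apply: rationalTM; first exact: regular_rationalT.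
    apply: rationalT_conj; have [p [q [q0 pq]]] := rPhi j k; exists p, q.
    exact: aeT_and (aeT_horner_neq0 q0) pq.
  have AM : aeT (fun z => `|A z i j| <= (M%:C)%C).
    by apply: aeT_imp (aeT_and fE fM) => t [->].
  have [g rg gE] := bounded_H2_rational_regular (hA i j) AM (rationalT_ae fE rf).
  by exists g.
have [h hE] := choice entry.
exists (fun z => \matrix_(i, j) h (i, j) z).
  by move=> i j; under eq_fun do rewrite mxE; have [] := hE (i, j).
have : aeT (fun z => forall i j, A z i j = h (i, j) z).
  by apply: aeT_forall => i; apply: aeT_forall => j; have [] := hE (i, j).
by apply: aeT_imp => t e; apply/matrixP => i j; rewrite mxE.
Qed.

End BlaschkePotapov.

Section ConstantComposition.
Context {R : realType}.
Local Notation C := R[i].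
Implicit Types f g : C -> C.

Definition contT f := continuous (fun t : R => complex.Re (f (circle t))) /\
  continuous (fun t : R => complex.Im (f (circle t))).

Lemma contT_cst (c : C) : contT (fun=> c).
Proof. by split=> t; exact: cvg_cst. Qed.

Lemma contTD f g : contT f -> contT g -> contT (fun z => f z + g z).
Proof.
move=> [fr fi] [gr gi]; split=> t.
  by under eq_fun do rewrite Re_add; apply: cvgD; [exact: fr | exact: gr].
by under eq_fun do rewrite Im_add; apply: cvgD; [exact: fi | exact: gi].
Qed.

Lemma contTM f g : contT f -> contT g -> contT (fun z => f z * g z).
Proof.
move=> [fr fi] [gr gi]; split=> t.
  under eq_fun do rewrite Re_mul.
  by apply: cvgB; apply: cvgM; [exact: fr | exact: gr | exact: fi | exact: gi].
under eq_fun do rewrite Im_mul.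
by apply: cvgD; apply: cvgM; [exact: fr | exact: gi | exact: fi | exact: gr].
Qed.

Lemma contT_conj f : contT f -> contT (fun z => (f z)^*).
Proof.
move=> [fr fi]; split=> t; first by under eq_fun do rewrite Re_conjC; exact: fr.
by under eq_fun do rewrite Im_conjC; apply: cvgN; exact: fi.
Qed.

Lemma contT_sum (I : Type) (r : seq I) (F : I -> C -> C) : (forall i, contT (F i)) ->
  contT (fun z => \sum_(i <- r) F i z).
Proof.
move=> cF; elim: r => [|i r IH]; first by under eq_fun do rewrite big_nil; exact: contT_cst.
by under eq_fun do rewrite big_cons; exact: contTD.
Qed.

(** A property that holds a.e. holds on a dense set. *)
Lemma continuous_eq_dense (u : R -> R) (t0 : R) (P : C -> Prop) : continuous u ->
  aeT P -> (forall t, P (circle t) -> u t = 0) -> 0 <= t0 <= 2 * pi -> u t0 = 0.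
Proof.
move=> cu hP hu t0b; apply/eqP; apply: contrapT => /negP u0.
have /cvgrPdist_lt/(_ `|u t0|) := cu t0; rewrite normr_gt0 => /(_ u0).
move=> /nbhs_ballP[d /= d0 hd].
have [t [_ td Pt]] := aeT_dense hP t0b d0.
have := hd t; rewrite /ball/= distrC => /(_ td).
by rewrite (hu t Pt) subr0 ltxx.
Qed.

Lemma contT_eq f g (c : C) : contT f -> contT g -> `|c| = 1 -> aeT (fun z => f z = g z) ->
  f c = g c.
Proof.
move=> cf cg c1 fg.
have [dr di] : contT (fun z => f z + - 1 * g z).
  by apply: contTD => //; apply: contTM => //; exact: contT_cst.
have fg' t : f (circle t) = g (circle t) -> f (circle t) + - 1 * g (circle t) = 0.
  by move=> ->; rewrite mulN1r subrr.
apply/eqP; rewrite -subr_eq0 -mulN1r -(circle_angle c1); apply/eqP.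
have cb := angle_bound c1.
apply: complex_ext.
  by apply: (continuous_eq_dense dr fg) => // t /fg' ->.
by apply: (continuous_eq_dense di fg) => // t /fg' ->.
Qed.

Lemma continuousT_mul n m p (F : C -> 'M[C]_(n, m)) (G : C -> 'M[C]_(n, p)) i j :
  continuousT F -> continuousT G -> contT (fun z => ((F z)^t* *m G z) i j).
Proof.
move=> cF cG; under eq_fun do rewrite mxE.
apply: contT_sum => k; apply: contTM; last exact: cG.
by under eq_fun do rewrite !mxE; apply: contT_conj; exact: cF.
Qed.

Lemma inner_pointwise n (F : C -> 'M[C]_n) (c : C) : `|c| = 1 -> continuousT F ->
  inner F -> (F c)^t* *m F c = 1%:M.
Proof.
move=> c1 cF [_ iso]; apply/matrixP => i j.
apply: (@contT_eq (fun z => ((F z)^t* *m F z) i j) (fun=> 1%:M i j)) => //.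
- exact: continuousT_mul.
- exact: contT_cst.
- by apply: aeT_imp iso => t ->.
Qed.

End ConstantComposition.

Theorem theorem4p38 (R : realType) (n : nat) (Phi A Theta : R[i] -> 'M[R[i]]_n)
  (hPhi : Hinfty Phi) (hrat : rational_mx Phi)
  (hdet : ~ aeT (fun z => \det (Phi z) = 0))
  (hfact : left_coprime_factorization Phi A Theta)
  (hTheta : finite_blaschke_potapov Theta)
  (omega : R[i] -> R[i]) (homega : finite_blaschke_product omega)
  (hcPhi : composable Phi omega) (hcA : composable A omega)
  (hcTheta : composable Theta omega) :
  left_coprime_factorization (Phi \o omega) (A \o omega) (Theta \o omega).
Proof.
have [innerT h2A factE cop] := hfact.
have [c [s [c1 hs omegaE]]] := homega.
case: s hs omegaE => [|a s] hs omegaE.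
  (* omega is a unimodular constant c: all three functions become constant, and the
     unitary matrix Theta c alone gives the Bezout identity. *)
  have om z : omega z = c by rewrite omegaE big_nil mulr1.
  have const : exists c : R[i], forall z, `|z| = 1 -> omega z = c by exists c.
  have cP := hcPhi const; have cA := hcA const; have cT := hcTheta const.
  have TT := inner_pointwise c1 cT innerT.
  have om_eq (F : R[i] -> 'M[R[i]]_n) : F \o omega = (fun=> F c).
    by apply/funext => z; rewrite /= om.
  rewrite !om_eq; split.
  - split; first by move=> i j; apply: regular_Hoo; exact: regular_cst.
    exact: aeT_all.
  - by move=> i j; exact: H2_cst.
  - apply: aeT_all => _; apply/matrixP => i j.
    apply: (@contT_eq _ (fun z => Phi z i j) (fun z => ((A z)^t* *m Theta z) i j)) => //.
    + exact: continuousT_mul.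
    + by apply: aeT_imp factE => t ->.
  - apply: (@left_coprime_bezout _ _ _ _ _ _ (fun=> 0) (fun=> (Theta c)^t*)).
    + exact: regular_mx_cst.
    + exact: regular_mx_cst.
    + by apply: aeT_all => _; rewrite mulmx0 add0r (mulmx1C TT).
have rom : regular omega.
  by apply: regular_eq (blaschke_product_regular c hs) => z _; rewrite omegaE.
have om1 t : `|omega (circle t)| = 1.
  by rewrite omegaE normrM c1 mul1r norm_blaschke_product_circle ?norm_circle.
have omle z : `|z| <= 1 -> `|omega z| <= 1.
  by move=> z1; rewrite omegaE normrM c1 mul1r norm_blaschke_product_le1.
have om0 : `|omega 0| < 1.
  rewrite omegaE normrM c1 mul1r big_cons normrM.
  have a1 : `|a| < 1 by apply: hs; rewrite mem_head.
  have -> : `|blaschke_factor a 0| = `|a|.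
    by rewrite /blaschke_factor sub0r mulr0 subr0 divr1 normrN.
  rewrite (le_lt_trans _ a1)// ler_piMr// norm_blaschke_product_le1 ?normr0//.
  by move=> b bs; apply: hs; rewrite in_cons bs orbT.
have pull P : aeT P -> aeT (fun z => P (omega z)).
  exact: (aeT_comp om0 rom om1 erefl).
have pullm f : measT f -> measT (fun z => f (omega z)).
  exact: (measT_comp rom om1).
have [T [rT TE Tunit]] := blaschke_potapov_regular hTheta.
have [A' rA AE] := cofactor_regular hPhi hrat innerT h2A factE rT TE.
have [X [Y [rX rY bez]]] : exists X Y, [/\ regular_mx X, regular_mx Y &
    forall z, `|z| <= 1 -> A' z *m X z + T z *m Y z = 1%:M].
  apply: regular_bezout => // al.
  (* on the circle itself T is invertible; in the open disc coprimeness is used *)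
  rewrite le_eqVlt => /orP[/eqP al1|al1].
    by exists 0, (invmx (T al)); rewrite mulmx0 add0r mulmxV// Tunit.
  exact: left_coprime_pointwise AE TE cop al1.
have rA' := regular_mx_comp rA rom omle; have rT' := regular_mx_comp rT rom omle.
split.
- split; last exact: pull innerT.2.
  move=> i j.
  apply: (proj2 (HpT_ae_regular _ _ (rT' i j))).
    by apply: (pullm (fun z => Theta z i j)); have [/LpT_measT] := innerT.1 i j.
  by apply: aeT_imp (pull _ TE) => t /= ->.
- move=> i j; apply: (proj1 (HpT_ae_regular _ _ (rA' i j))).
    by apply: (pullm (fun z => A z i j)); have [/LpT_measT] := h2A i j.
  by apply: aeT_imp (pull _ AE) => t /= ->.
- exact: pull factE.
- apply: (@left_coprime_bezout _ _ _ _ _ _ (fun z => X (omega z)) (fun z => Y (omega z))).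
  + exact: regular_mx_comp.
  + exact: regular_mx_comp.
  + apply: aeT_imp (aeT_and (pull _ AE) (pull _ TE)) => t /= [-> ->].
    by apply: bez; rewrite om1.
Qed.
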